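(* Let $W$ be a finite Coxeter group. Then the shard intersection order $\preceq$ on $W$ coincides with the kappa order $\leq_\kappa$ with respect to the right weak order $\leq$ on $W$; that is, for $x,y\in W$, $x\preceq y$ if and only if $x\le y$ and $\overline{\kappa}(x)\ge\overline{\kappa}(y)$.
   Context: Right weak order: $x\le y$ iff $\ell(y)=\ell(x)+\ell(x^{-1}y)$, where $\ell$ is the Coxeter length. For finite $W$, $L=(W,\le)$ is a finite semidistributive lattice (i.e. $a\vee x=a\vee y$ implies $a\vee(x\wedge y)=a\vee x$, and dually). Extended kappa map on a finite semidistributive lattice $L$: an element $j$ is join-irreducible if it covers exactly one element $j_*$; for such $j$, $\kappa(j):=\max\{x\in L\mid j\wedge x=j_*\}$ (which exists). Every $x\in L$ has a unique canonical join representation $x=\bigvee A$: $A=:\mathsf{CJR}(x)$ is an antichain such that whenever $x=\bigvee B$, each $a\in A$ satisfies $a\le b$ for some $b\in B$; its elements are join-irreducible. Then $\overline{\kappa}(x):=\bigwedge\{\kappa(j)\mid j\in\mathsf{CJR}(x)\}$, and the kappa order is $x\leq_\kappa y$ iff $x\le y$ and $\overline{\kappa}(x)\ge\overline{\kappa}(y)$. Shard intersection order (Reading): realize $W$ as a finite real reflection group on $V$ with reflecting hyperplane arrangement $\mathcal{H}$ and a base region $D$ (closed chamber) whose walls are the hyperplanes of the simple reflections; identify $w\in W$ with the region $wD$. For distinct $H,H'\in\mathcal{H}$ let $\mathcal{H}(H,H')$ be the set of hyperplanes of $\mathcal{H}$ containing $H\cap H'$; its basic hyperplanes are the two that bound the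 region of $\mathcal{H}(H,H')$ containing $D$. Say $H'$ cuts $H$ if $H'$ is basic in $\mathcal{H}(H,H')$ and $H$ is not. The shards in $H$ are the closures of the connected components of $H\setminus\bigcup_{H'\text{ cuts }H}(H\cap H')$. For $w\in W$ and each simple reflection $s$ with $ws<w$, the common facet of $wD$ and $wsD$ is contained in a unique shard; these shards are the lower shards of $w$. Let $\Gamma(w)$ be the intersection of all lower shards of $w$ ($\Gamma(w)=V$ if there are none). Then $x\preceq y$ iff $\Gamma(x)\supseteq\Gamma(y)$. (The paper identifies this order with the core label order of the lattice $(W,\le)$: $x\leq_{\mathsf{CLO}}y$ iff $\mathsf{j\text{-}label}[x_\downarrow,x]\subseteq\mathsf{j\text{-}label}[y_\downarrow,y]$, where $x_\downarrow$ is the meet of $x$ and all elements covered by $x$, and $\mathsf{j\text{-}label}[a,b]=\{j\text{ join-irreducible}\mid j\le b,\ \kappa(j)\ge a\}$.) *)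

(* Defs.v *)
From HB Require Import structures.
From mathcomp Require Import all_boot all_order all_algebra all_fingroup.
From mathcomp Require Import mxrepresentation.
From mathcomp Require Import all_classical all_reals.
From mathcomp Require Import topology normedtype.

Set Implicit Arguments.
Unset Strict Implicit.
Unset Printing Implicit Defensive.

Import Order.TTheory GRing.Theory Num.Theory.
Import numFieldNormedType.Exports.
Local Open Scope classical_set_scope.

(* The presentation < S | (s t)^m(s,t) = 1 >, with m(s,t) the order of s t,
   is expressed by its universal property; uniqueness of the extension [phi]
   follows from [simple_gen]. *)
Record coxeter_system (W : finGroupType) := CoxeterSystem {
  simple :> {set W};
  simple_order : forall s, s \in simple -> #[s]%g = 2%N;
  simple_gen : <<simple>>%g = [set: W]%SET;
  simple_pres : forall (G : groupType) (f : W -> G),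
    (forall s t, s \in simple -> t \in simple ->
       ((f s * f t) ^+ #[s * t])%g = 1%g) ->
    exists phi : {multiplicative W -> G},
      forall s, s \in simple -> phi s = f s
}.

Section WeakOrder.
Variables (W : finGroupType) (C : coxeter_system W).

Definition has_word (w : W) (k : nat) : bool :=
  [exists c : {ffun 'I_k -> W},
    [forall i, c i \in simple C] && ((\prod_i c i)%g == w)].

Lemma has_wordP w k :
  reflect (exists2 c : 'I_k -> W,
             forall i, c i \in simple C & (\prod_i c i)%g = w)
          (has_word w k).
Proof.
apply: (iffP existsP) => [[c /andP[/forallP Sc /eqP cw]]|[c Sc cw]].
  by exists c.
exists (finfun c); apply/andP; split; first by apply/forallP => i; rewrite ffunE.
by apply/eqP; rewrite -cw; apply: eq_bigr => i _; rewrite ffunE.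
Qed.

Lemma has_word_ex w : exists k, has_word w k.
Proof.
have: w \in <<simple C>>%g by rewrite simple_gen finset.inE.
by case/gen_prodgP => k [c Sc ->]; exists k; apply/has_wordP; exists c.
Qed.

Definition length (w : W) : nat := ex_minn (has_word_ex w).

Lemma length_word w : has_word w (length w).
Proof. by rewrite /length; case: ex_minnP. Qed.

Lemma length_min w k : has_word w k -> (length w <= k)%N.
Proof. by rewrite /length; case: ex_minnP => m _ min_m /min_m. Qed.

Lemma length1 : length 1%g = 0%N.
Proof.
apply/eqP; rewrite -leqn0; apply: length_min; apply/has_wordP.
by exists (fun=> 1%g); [case | rewrite big_ord0].
Qed.

Lemma length_eq0 w : length w = 0%N -> w = 1%g.
Proof.
move=> lw0; have := length_word w; rewrite lw0 => /has_wordP[c _ <-].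
by rewrite big_ord0.
Qed.

Lemma lengthM v w : (length (v * w)%g <= length v + length w)%N.
Proof.
have /has_wordP[c Sc cv] := length_word v.
have /has_wordP[d Sd dw] := length_word w.
apply: length_min; apply/has_wordP.
exists (fun i => match fintype.split i with inl a => c a | inr b => d b end).
  by move=> i; case: (fintype.split i).
rewrite big_split_ord /=; congr (_ * _)%g; [rewrite -[RHS]cv|rewrite -[RHS]dw].
  by apply: eq_bigr => i _; rewrite (unsplitK (inl i)).
by apply: eq_bigr => i _; rewrite (unsplitK (inr i)).
Qed.

Definition weak_le (x y : W) : bool :=
  length y == (length x + length (x^-1 * y)%g)%N.

Lemma weak_le_refl : reflexive weak_le.
Proof. by move=> x; rewrite /weak_le mulVg length1 addn0. Qed.

Lemma weak_le_anti : antisymmetric weak_le.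
Proof.
move=> x y /andP[/eqP xy /eqP yx].
suff /length_eq0 e : length (x^-1 * y)%g = 0%N.
  by rewrite -[RHS](mulKVg x) e mulg1.
by apply/eqP; rewrite -leqn0 -(leq_add2l (length x)) -xy addn0 yx leq_addr.
Qed.

Lemma weak_le_trans : transitive weak_le.
Proof.
move=> y x z /eqP xy /eqP yz; rewrite /weak_le eqn_leq; apply/andP; split.
  by rewrite -{1}(mulKVg x z) lengthM.
rewrite yz xy -addnA leq_add2l.
by rewrite -{1}(mulKVg y z) mulgA lengthM.
Qed.

End WeakOrder.

Definition weak (W : finGroupType) (C : coxeter_system W) : Type := W.

Fact weak_display : Order.disp_t. Proof. exact: (Order.Disp tt tt). Qed.

HB.instance Definition _ (W : finGroupType) (C : coxeter_system W) :=
  Finite.copy (weak C) W.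
HB.instance Definition _ (W : finGroupType) (C : coxeter_system W) :=
  Order.Le_isPOrder.Build weak_display (weak C)
    (@weak_le_refl W C) (@weak_le_anti W C) (@weak_le_trans W C).

(* The lattice operations are rendered by [supremums] / [infimums] (the sets,
   with at most one element, of least upper / greatest lower bounds), so that
   the definitions make sense on any finite poset; the objects they describe
   are unique, and exist when the poset is a semidistributive lattice. *)
Section KappaOrder.
Context {d : Order.disp_t} {L : finPOrderType d}.
Implicit Types (x y j k : L) (A B : set L).
Local Open Scope order_scope.

Definition lower_covers x : set L :=
  [set c | c < x /\ ~ exists z : L, c < z /\ z < x].

(* [j] is join-irreducible with unique lower cover [jl], and [k] is the
   greatest element of {x | j /\ x = jl}. *)
Definition is_kappa j k : Prop :=
  exists2 jl : L, lower_covers j = [set jl] &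
    let X := [set x | infimums [set j; x] jl] in X k /\ ubound X k.

Definition is_CJR x A : Prop :=
  [/\ supremums A x,
      forall a b, A a -> A b -> a <= b -> a = b
    & forall B, supremums B x -> forall a, A a -> exists2 b, B b & a <= b].

(* The infimum of the empty family (x the bottom) is the top of L. *)
Definition is_ext_kappa x k : Prop :=
  exists2 A, is_CJR x A &
    exists2 kappa : L -> L, forall j, A j -> is_kappa j (kappa j) &
      infimums (kappa @` A) k.

Definition kappa_le x y : Prop :=
  x <= y /\
  exists kx ky, [/\ is_ext_kappa x kx, is_ext_kappa y ky & ky <= kx].

End KappaOrder.

Arguments kappa_le {d} L x y.

Section Arrangements.
Variables (R : realType) (n : nat).
Local Notation V := 'cV[R]_n.
Implicit Types (A : set (set V)) (D H X : set V).
Local Open Scope ring_scope.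

Definition dot (u v : V) : R := (u^T *m v) 0 0.

Definition is_reflection (M : 'M[R]_n) : Prop :=
  exists2 a : V, a != 0 &
    forall v : V, M *m v = v - (2 * dot v a / dot a a) *: a.

Definition fixed_space (M : 'M[R]_n) : set V := [set v | M *m v = v].

Definition closed_components X : set (set V) :=
  [set closure (connected_component X v) | v in X].

Definition regions A : set (set V) :=
  closed_components (~` \bigcup_(H in A) H).

(* H meets D in a subset with nonempty interior relative to H, that is, in
   a face of codimension 1. *)
Definition is_wall D H : Prop := exists2 v, H v & within H (nbhs v) D.

Definition rank2 A H H' : set (set V) := [set K | A K /\ H `&` H' `<=` K].

Definition basic A D H H' K : Prop :=
  rank2 A H H' K /\
  exists E, [/\ regions (rank2 A H H') E, D `<=` E & is_wall E K].

Definition cuts A D H' H : Prop :=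
  [/\ A H, A H', H <> H', basic A D H H' H' & ~ basic A D H H' H].

Definition shards_in A D H : set (set V) :=
  closed_components (H `\` \bigcup_(H' in [set H' | cuts A D H' H]) (H `&` H')).

Definition shards A D : set (set V) := \bigcup_(H in A) shards_in A D H.

End Arrangements.

Section ShardOrder.
Variables (W : finGroupType) (C : coxeter_system W).
Variables (R : realType) (n : nat).
Variables (rho : mx_representation R [set: W]%G n) (D : set 'cV[R]_n).

(* W acts on column vectors, on the left. *)
Definition arrangement : set (set 'cV[R]_n) :=
  [set fixed_space (rho t) | t in [set t : W | is_reflection (rho t)]].

(* The simple reflections being orthogonal and generating W, the image of rho
   is a finite group of isometries generated by reflections. *)
Record is_realization : Prop := IsRealization {
  real_faithful : mx_faithful rho;
  real_reflection : forall s, s \in simple C -> is_reflection (rho s);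
  real_region : regions arrangement D;
  real_walls : [set H | arrangement H /\ is_wall D H]
             = [set fixed_space (rho s) | s in [set s | s \in simple C]]
}.

Definition region (w : W) : set 'cV[R]_n := [set rho w *m v | v in D]%R.

Definition lower_shards (w : W) : set (set 'cV[R]_n) :=
  [set Z | shards arrangement D Z /\
    exists s : W, [/\ s \in simple C,
      (((w * s)%g : weak C) < (w : weak C))%O
    & region w `&` region (w * s)%g `<=` Z]].

Definition shard_meet (w : W) : set 'cV[R]_n :=
  \bigcap_(Z in lower_shards w) Z.

Definition shard_le (x y : W) : Prop := shard_meet y `<=` shard_meet x.

End ShardOrder.

(* Main.v *)
From HB Require Import structures.
Require Import Defs.
From mathcomp Require Import all_boot all_order all_algebra all_fingroup.
From mathcomp Require Import mxrepresentation.
From mathcomp Require Import all_classical all_reals.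
From mathcomp Require Import topology normedtype.
From mathcomp Require Import ring lra zify.

(** Proof idea.  Everything is read off the inversion set [N w] of reflections whose
    hyperplane separates [wD] from [D]; [x <= y] iff [N x] is contained in [N y].
    If [y] covers [y'] across the hyperplane of [t], then, by descending through faces
    of the chamber of [y], there is a least [j <= y] with [t] in [N j], and dually a
    greatest [m >= y'] with [t] not in [N m].  These [j] form the canonical join
    representation of [y], [m = kappa j], and the extended kappa image [k] of [y] is
    the meet of the [m].

    The geometric point is that the root of [t] is not a positive combination of two
    other roots vanishing at a point where the shard is not cut, so it is simple for
    the parabolic subgroup of that point.  Moving along a segment inside the shard
    from the facet of [j], this shows that all roots of [N j] stay nonpositive on the
    shard; dually all roots outside [N m] stay nonnegative.  Hence
    [Gamma y] consists of the points [p] on which [N y] is nonpositive and the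
    complement of [N k] is nonnegative.  So [x <= y] and [k_y <= k_x] imply that
    [Gamma y] is contained in [Gamma x]; the converse follows by testing on relative
    interior points of the face of [y] cut out by its lower facets and of the face of
    [k_y] cut out by the matching upper facets, which both lie in [Gamma y]. *)

Set Implicit Arguments.
Unset Strict Implicit.
Unset Printing Implicit Defensive.

Import Order.TTheory GRing.Theory Num.Theory.
Import numFieldNormedType.Exports.
Local Open Scope classical_set_scope.
Local Open Scope ring_scope.

(** * Sign cones and connected components *)

Section Dot.
Variables (R : realType) (n : nat).
Local Notation V := 'cV[R]_n.
Implicit Types (u v w : V) (c : R).

Lemma dotE u v : dot u v = \sum_i u i 0 * v i 0.
Proof. by rewrite /dot mxE; apply: eq_bigr => i _; rewrite mxE. Qed.

Lemma dotC u v : dot u v = dot v u.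
Proof. by rewrite !dotE; apply: eq_bigr => i _; rewrite mulrC. Qed.

Lemma dotDl u v w : dot (u + v) w = dot u w + dot v w.
Proof. by rewrite /dot linearD mulmxDl mxE. Qed.

Lemma dotZl c u v : dot (c *: u) v = c * dot u v.
Proof. by rewrite /dot linearZ /= -scalemxAl mxE. Qed.

Lemma dotDr u v w : dot u (v + w) = dot u v + dot u w.
Proof. by rewrite dotC dotDl !(dotC u). Qed.

Lemma dotZr c u v : dot u (c *: v) = c * dot u v.
Proof. by rewrite dotC dotZl dotC. Qed.

Lemma dotNl u v : dot (- u) v = - dot u v.
Proof. by rewrite -scaleN1r dotZl mulN1r. Qed.

Lemma dotNr u v : dot u (- v) = - dot u v.
Proof. by rewrite dotC dotNl dotC. Qed.

Lemma dotBl u v w : dot (u - v) w = dot u w - dot v w.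
Proof. by rewrite dotDl dotNl. Qed.

Lemma dotBr u v w : dot u (v - w) = dot u v - dot u w.
Proof. by rewrite dotDr dotNr. Qed.

Lemma dot_suml (I : finType) (P : pred I) (F : I -> V) v :
  dot (\sum_(i | P i) F i) v = \sum_(i | P i) dot (F i) v.
Proof. by rewrite /dot linear_sum mulmx_suml summxE. Qed.

Lemma dot_gt0 u : u != 0 -> 0 < dot u u.
Proof.
move=> u0; have /cV0Pn[i ui] : u != 0 by [].
rewrite dotE (bigD1 i) //= ltr_pwDl //; last first.
  by apply: sumr_ge0 => j _; rewrite -expr2 sqr_ge0.
by rewrite -expr2 exprn_even_gt0.
Qed.

Lemma dot_ext u v : (forall w, dot w u = dot w v) -> u = v.
Proof.
move=> e; apply/eqP; rewrite -subr_eq0; apply: contraT => /dot_gt0.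
by rewrite dotBr e subrr ltxx.
Qed.

Lemma dot_continuous v : continuous (fun u => dot u v).
Proof.
rewrite (_ : (fun _ => _) = (fun u : V => \sum_i u i 0 * v i 0)); last first.
  by apply/funext => u; rewrite dotE.
apply: continuous_big => [|i _ u]; first exact: add_continuous.
apply: (@cvgM _ _ (nbhs u) _ (fun u : V => u i 0) (fun=> v i 0)); last exact: cvg_cst.
exact: (@coord_continuous R n 1 i 0).
Qed.

Lemma scaled_dot_continuous c v : continuous (fun u => c * dot u v).
Proof.
move=> u; apply: (@cvgM _ _ (nbhs u) _ (fun=> c) (fun u : V => dot u v)).
  exact: cvg_cst.
exact: dot_continuous.
Qed.

Lemma segment_continuous u v : continuous (fun c : R => u + c *: v).
Proof.
by move=> c; apply: cvgD; [exact: cvg_cst | exact: cvgZr_tmp].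
Qed.

End Dot.

Section SignCones.
Variables (R : realType) (n : nat) (I : Type).
Local Notation V := 'cV[R]_n.
Variables (P : I -> Prop) (f : I -> V) (E : set V).
Hypothesis convexE : forall u v c, 0 <= c <= 1 -> E u -> E v -> E (u + c *: (v - u)).

Let X : set V := [set p | E p /\ forall i, P i -> dot p (f i) != 0].

(** A linear form that never vanishes on a connected set keeps its sign there. Conversely, convexity
    of [E] keeps the segment from [v] to [p] inside [X] when all signs agree. *)
Lemma connected_component_signs v : X v ->
  connected_component X v =
  [set p | E p /\ forall i, P i -> 0 < dot v (f i) * dot p (f i)].
Proof.
move=> [Ev v0]; apply/seteqP; split => p /=.
  move=> [B [Bv BX cB] Bp]; split=> [|i Pi]; first by have [] := BX _ Bp.
  rewrite ltNge; apply/negP => le0.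
  pose g q := dot v (f i) * dot q (f i).
  have : connected (g @` B).
    apply: connected_continuous_connected => //; apply: continuous_subspaceT.
    exact: scaled_dot_continuous.
  move/connected_intervalP => /(_ (g p) (g v)).
  have gv : 0 <= g v by rewrite /g -expr2 sqr_ge0.
  case/(_ (imageP _ Bp) (imageP _ Bv) 0) => [|q Bq /eqP].
    by rewrite le0 gv.
  by rewrite mulf_eq0 (negPf (v0 i Pi)) /=; have [_ /(_ _ Pi)/negPf ->] := BX _ Bq.
move=> [Ep pos].
pose seg (c : R) := v + c *: (p - v).
have cseg : connected (seg @` `[0, 1]).
  apply: connected_continuous_connected; first exact: segment_connected.
  by apply: continuous_subspaceT; exact: segment_continuous.
exists (seg @` `[0, 1]); last first.
  by exists 1; rewrite /= ?in_itv /= ?lexx ?ler01 // /seg scale1r addrC subrK.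
split=> //; first by exists 0; rewrite /= ?in_itv /= ?lexx ?ler01 // /seg scale0r addr0.
move=> _ [c /= c01 <-]; rewrite in_itv /= in c01.
split=> [|i Pi]; first exact: convexE.
rewrite /seg dotDl dotZl dotBl; have := pos i Pi; have := v0 i Pi.
move: (dot v _) (dot p _) => a b a0 ab.
have a2 : 0 < a * a by rewrite -expr2 exprn_even_gt0.
apply/eqP => /(congr1 ( *%R a)); rewrite mulr0.
have -> : a * (a + c * (b - a)) = (1 - c) * (a * a) + c * (a * b) by ring.
case/andP: c01 => c0 c1; have [->|c1'] := eqVneq c 1; first by nra.
have : 0 < 1 - c by rewrite subr_gt0 lt_neqAle c1'.
nra.
Qed.

(** A point of the closed cone is approached along the segment towards [v], on which every sign
    becomes strict. *)
Lemma closure_component_signs v : closed E -> X v ->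
  closure (connected_component X v) =
  [set p | E p /\ forall i, P i -> 0 <= dot v (f i) * dot p (f i)].
Proof.
move=> cE Xv; rewrite connected_component_signs //.
have [Ev v0] := Xv; apply/seteqP; split => p /=.
  move=> clp; split=> [|i Pi].
    by apply: cE => B /clp[q [[Eq _] Bq]]; exists q.
  pose g q := dot v (f i) * dot q (f i).
  have cg : continuous g by exact: scaled_dot_continuous.
  have /(_ p) : closed (g @^-1` [set x | 0 <= x]).
    by apply: preimage_closed; [move=> ? _; exact: cg | exact: closed_ge].
  by apply => B /clp[q [[_ /(_ _ Pi)/ltW q0] Bq]]; exists q.
move=> [Ep pos] B Bp.
have := @segment_continuous R n p (v - p) 0 B; rewrite scale0r addr0 => /(_ Bp).
case/nbhs_ballP => e /= e0 /= eB.
(* The bound 1 keeps the point on the segment to [v], and [e / 2] keeps the parameter in the ball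
   mapped into [B]. *)
pose c := Num.min 1 (e / 2).
have c0 : 0 < c by rewrite lt_min ltr01 divr_gt0.
have c1 : c <= 1 by rewrite ge_min lexx.
exists (p + c *: (v - p)); split; last first.
  apply: eB; rewrite /ball /= sub0r normrN gtr0_norm //.
  by rewrite gt_min; apply/orP; right; rewrite ltr_pdivrMr // ltr_pMr // ltr1n.
split=> [|i Pi]; first by apply: convexE => //; rewrite (ltW c0).
rewrite dotDl dotZl dotBl; have := pos i Pi; have := v0 i Pi.
move: (dot v _) (dot p _) => a b a0 ab.
have a2 : 0 < a * a by rewrite -expr2 exprn_even_gt0.
have -> : a * (b + c * (a - b)) = (1 - c) * (a * b) + c * (a * a) by ring.
nra.
Qed.

End SignCones.

(** * Inversion sets *)

Section Normals.
Variables (R : realType) (n : nat).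
Local Notation V := 'cV[R]_n.

Definition is_normal (M : 'M[R]_n) (a : V) : Prop :=
  a != 0 /\ forall v : V, M *m v = v - (2 * dot v a / dot a a) *: a.

Lemma normal_opp M a : is_normal M a -> M *m a = - a.
Proof.
move=> [/dot_gt0 a0 ->]; rewrite mulfK ?gt_eqF // scaler_nat mulr2n opprD.
by rewrite addrA subrr add0r.
Qed.

Lemma normal_scale M a b : is_normal M a -> is_normal M b ->
  exists2 c, c != 0 & a = c *: b.
Proof.
move=> na [_ Mb]; pose c := dot a b / dot b b.
have ac : a = c *: b.
  have := Mb a; rewrite (normal_opp na) => /eqP.
  rewrite eq_sym subr_eq addrC -subr_eq opprK -mulr2n -scaler_nat.
  rewrite -mulrA -scalerA => /eqP/scalerI -> //.
  by rewrite pnatr_eq0.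
exists c => //; apply: contra_neq na.1 => c0.
by rewrite ac c0 scale0r.
Qed.

Lemma fixed_normal M a : is_normal M a -> fixed_space M = [set v | dot v a = 0].
Proof.
move=> [a0 Ma]; apply/seteqP; split=> v /=; rewrite /fixed_space /= Ma.
  move/eqP; rewrite -subr_eq0 addrAC subrr add0r oppr_eq0 scaler_eq0 (negPf a0).
  rewrite orbF !mulf_eq0 invr_eq0 (gt_eqF (dot_gt0 a0)) pnatr_eq0 orbF /=.
  by move/eqP.
by move=> ->; rewrite mulr0 mul0r scale0r subr0.
Qed.

Lemma normal_isometry M a u v : is_normal M a -> dot (M *m u) (M *m v) = dot u v.
Proof.
move=> [/dot_gt0 a0 Ma]; rewrite !Ma !(dotBl, dotBr, dotZl, dotZr) (dotC a v).
by field; rewrite gt_eqF.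
Qed.

(** The part [r] of [b] orthogonal to [a] is also orthogonal to [b] by hypothesis, hence to itself,
    so it vanishes. *)
Lemma same_kernel_scale (a b : V) : a != 0 -> 
  (forall v, dot v a = 0 -> dot v b = 0) -> exists c, b = c *: a.
Proof.
move=> a0 ab; exists (dot b a / dot a a).
have aa := dot_gt0 a0.
pose r := b - (dot b a / dot a a) *: a.
have ra : dot r a = 0.
  by rewrite dotBl dotZl -mulrA mulVf ?gt_eqF // mulr1 subrr.
have : dot r r = 0 by rewrite {2}/r dotBr dotZr ra mulr0 ab ?subr0.
move/eqP; have [r0 _|/dot_gt0/gt_eqF-> //] := eqVneq r 0.
by apply/eqP; rewrite -subr_eq0; apply/eqP.
Qed.

End Normals.

HB.lock Definition reflections (W : finGroupType) (R : realType) (n : nat)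
    (rho : mx_representation R [set: W]%G n) : {set W} :=
  [set t | `[< is_reflection (rho t) >]]%SET.

Lemma reflectionP (W : finGroupType) (R : realType) (n : nat)
    (rho : mx_representation R [set: W]%G n) t :
  (t \in reflections rho) <-> exists a, is_normal (rho t) a.
Proof.
rewrite reflections.unlock finset.inE; split=> [/asboolP[a a0 ta]|[a [a0 ta]]].
  by exists a.
by apply/asboolP; exists a.
Qed.

(* [base] is an interior point of the base chamber, [pos_root t] the normal of the
   hyperplane of [t] on the side of [base], and [wall_point s] an interior point of
   the facet of the base chamber in the hyperplane of [s]. *)
Record chamber_data (W : finGroupType) (C : coxeter_system W)
    (R : realType) (n : nat) (rho : mx_representation R [set: W]%G n) := ChamberData {
  pos_root : W -> 'cV[R]_n;
  base : 'cV[R]_n;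
  wall_point : W -> 'cV[R]_n;
  faithful_rho : mx_faithful rho;
  pos_rootP : forall t, t \in reflections rho -> is_normal (rho t) (pos_root t);
  base_gt0 : forall t, t \in reflections rho -> 0 < dot base (pos_root t);
  simple_reflection : forall s, s \in simple C -> s \in reflections rho;
  wall_point0 : forall s, s \in simple C -> dot (wall_point s) (pos_root s) = 0;
  wall_point_gt0 : forall s t, s \in simple C -> t \in reflections rho -> t != s ->
    0 < dot (wall_point s) (pos_root t)
}.

Definition vact (W : finGroupType) (R : realType) (n : nat)
    (rho : mx_representation R [set: W]%G n) (u : W) (v : 'cV[R]_n) : 'cV[R]_n :=
  rho u *m v.

(** Up to a positive factor, the signed distance to the hyperplane of a reflection [t], positive on
    the side of [base]. *)
Definition ht (W : finGroupType) (C : coxeter_system W) (R : realType) (n : nat)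
    (rho : mx_representation R [set: W]%G n) (G : chamber_data C rho)
    (t : W) (v : 'cV[R]_n) : R :=
  dot v (pos_root G t).

HB.lock Definition inversions (W : finGroupType) (C : coxeter_system W)
    (R : realType) (n : nat) (rho : mx_representation R [set: W]%G n)
    (G : chamber_data C rho) (u : W) : {set W} :=
  [set t in reflections rho | ht G t (vact rho u (base G)) < 0]%SET.

Section Inversions.
Variables (W : finGroupType) (C : coxeter_system W) (R : realType) (n : nat).
Variables (rho : mx_representation R [set: W]%G n) (G : chamber_data C rho).
Local Notation V := 'cV[R]_n.
Local Notation T := (reflections rho).
Local Notation S := (simple C).
Local Notation h := (ht G).
Local Notation N := (inversions G).
Local Notation act := (vact rho).
Implicit Types (s t u w : W) (v p o : V).


Lemma vactM u w v : act (u * w)%g v = act u (act w v).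
Proof. by rewrite /act repr_mxM ?finset.in_setT // mulmxA. Qed.

Lemma vact1 v : act 1%g v = v.
Proof. by rewrite /act repr_mx1 mul1mx. Qed.

Lemma vactK u v : act u^-1%g (act u v) = v.
Proof. by rewrite -vactM mulVg vact1. Qed.

Lemma vactVK u v : act u (act u^-1%g v) = v.
Proof. by rewrite -vactM mulgV vact1. Qed.

Lemma vactD u v p : act u (v + p) = act u v + act u p.
Proof. exact: linearD. Qed.

Lemma vactZ u c v : act u (c *: v) = c *: act u v.
Proof. exact: linearZ. Qed.

Lemma vactN u v : act u (- v) = - act u v.
Proof. exact: linearN. Qed.

Lemma vact_sum u (I : finType) (P : pred I) (F : I -> V) :
  act u (\sum_(i | P i) F i) = \sum_(i | P i) act u (F i).
Proof. exact: linear_sum. Qed.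

Lemma gen_word (K : {set W}) w : w \in <<K>>%g ->
  exists2 c : seq W, all (mem K) c & w = (\prod_(x <- c) x)%g.
Proof.
case/gen_prodgP => k [c Kc ->]; exists (codom c).
  by apply/allP => _ /codomP[i ->]; exact: Kc.
by rewrite big_map enumT.
Qed.

Lemma all_word w : exists2 c : seq W, all (mem S) c & w = (\prod_(x <- c) x)%g.
Proof. by apply: gen_word; rewrite simple_gen finset.in_setT. Qed.

Lemma dot_vact u v p : dot (act u v) (act u p) = dot v p.
Proof.
have [c + ->] := all_word u; elim: c => [|s c IH] /=.
  by rewrite big_nil !vact1.
case/andP=> Ss Sc; rewrite big_cons !vactM -[RHS]IH //.
by apply: (@normal_isometry _ _ _ (pos_root G s)); exact/pos_rootP/(simple_reflection G).
Qed.

Lemma dot_vactl u v p : dot (act u v) p = dot v (act u^-1%g p).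
Proof. by rewrite -[p in LHS](vactVK u) dot_vact. Qed.

Lemma normal_conj t u a : is_normal (rho t) a -> is_normal (rho (t ^ u)%g) (act u^-1%g a).
Proof.
move=> [a0 ta]; split.
  by apply: contra_neq a0 => a0; rewrite -(vactVK u a) a0 /act mulmx0.
move=> v; rewrite -[_ *m v]/(act _ v) conjgE !vactM.
rewrite [act t _]ta vactD vactN vactK dot_vact.
by rewrite vactZ dot_vactl.
Qed.

Lemma conj_reflection t u : ((t ^ u)%g \in T) = (t \in T).
Proof.
have imp x y : x \in T -> (x ^ y)%g \in T.
  by move/reflectionP => [a /normal_conj na]; apply/reflectionP; exists (act y^-1%g a).
by apply/idP/idP => [/(imp _ u^-1%g)|/imp//]; rewrite conjgK.
Qed.

Lemma in_inv u t : (t \in N u) = (t \in T) && (h t (act u (base G)) < 0).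
Proof. by rewrite inversions.unlock finset.inE. Qed.

Lemma inv_refl u t : t \in N u -> t \in T.
Proof. by rewrite in_inv => /andP[]. Qed.

Lemma ht_base t : t \in T -> 0 < h t (base G).
Proof. exact: base_gt0. Qed.

(** The root of [t] pulled back along [u] is a multiple of the root of [t ^ u]; evaluation at [base]
    shows that the factor is negative exactly for inversions. Most sign computations go through
    this. *)
Lemma ht_vact t u : t \in T ->
  exists2 c, 0 < c & forall v,
    h t (act u v) = (if t \in N u then - c else c) * h (t ^ u)%g v.
Proof.
move=> Tt; have Ttu : (t ^ u)%g \in T by rewrite conj_reflection.
have [c c0 ec] := normal_scale (normal_conj u (pos_rootP G Tt)) (pos_rootP G Ttu).
have htE v : h t (act u v) = c * h (t ^ u)%g v.
  by rewrite /h dot_vactl ec dotZr.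
exists `|c|; first by rewrite normr_gt0.
move=> v; rewrite in_inv Tt !htE /= pmulr_llt0 ?ht_base //.
by case: ltrP => [/ltr0_norm|/ger0_norm] ->; rewrite ?opprK.
Qed.

Lemma ht_vact_base t u : t \in T ->
  (h t (act u (base G)) < 0) = (t \in N u) /\
  (0 < h t (act u (base G))) = (t \notin N u).
Proof.
move=> Tt; have [c c0 /(_ (base G)) e] := ht_vact u Tt.
rewrite in_inv Tt /=; split=> //; rewrite -leNgt le_eqVlt eq_sym e mulf_eq0.
rewrite [h _ _ == _]gt_eqF ?ht_base ?conj_reflection // orbF.
by case: ifP; rewrite ?oppr_eq0 gt_eqF.
Qed.

Lemma ht_vact_base_neq0 t u : t \in T -> h t (act u (base G)) != 0.
Proof.
move=> Tt; have [neg pos] := ht_vact_base u Tt.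
by rewrite neq_lt neg pos orbN.
Qed.

Lemma inv1 : N 1%g = finset.set0.
Proof.
apply/finset.setP => t; rewrite finset.in_set0 in_inv vact1.
by apply/negP => /andP[/ht_base/ltW/le_gtF->].
Qed.

Lemma in_invM t u w : t \in T ->
  (t \in N (u * w)%g) = (t \in N u) (+) ((t ^ u)%g \in N w).
Proof.
move=> Tt; rewrite in_inv Tt vactM /=; have [c c0 ->] := ht_vact u Tt.
have [] := @ht_vact_base (t ^ u)%g w; first by rewrite conj_reflection.
case: ifP => _; first by rewrite mulNr oppr_lt0 pmulr_rgt0.
by rewrite pmulr_rlt0.
Qed.

Lemma act_reflection t v : t \in T -> h t v = 0 -> act t v = v.
Proof.
by move=> /(pos_rootP G)[_ /(_ v)]; rewrite /act /h => -> ->; rewrite mulr0 mul0r scale0r subr0.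
Qed.

Lemma ht_reflection t v : t \in T -> h t (act t v) = - h t v.
Proof.
move=> Tt; rewrite /h dot_vactl; have [_ tE] := pos_rootP G Tt.
have tt : act t (pos_root G t) = - pos_root G t by exact: normal_opp (pos_rootP G Tt).
have {1}-> : pos_root G t = - act t (pos_root G t) by rewrite tt opprK.
by rewrite vactN vactK dotNr.
Qed.

(** The wall point of [s] is fixed by [s], and every other root is positive there, so no other root
    can change sign. *)
Lemma inv_simple s : s \in S -> N s = [set s]%SET.
Proof.
move=> Ss; have Ts := simple_reflection G Ss.
apply/finset.setP => t; rewrite finset.inE; have [->|ts] := eqVneq t s.
  by rewrite in_inv Ts ht_reflection // oppr_lt0 ht_base.
apply/negP => it; have Tt := inv_refl it.
have [c c0 /(_ (wall_point G s))] := ht_vact s Tt.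
rewrite it (act_reflection Ts (wall_point0 G Ss)) => e.
have : 0 < h t (wall_point G s) by exact: wall_point_gt0.
rewrite e mulNr oppr_gt0 pmulr_rlt0 // ltNge ltW //.
apply: wall_point_gt0; rewrite ?conj_reflection //.
by apply: contra_neq ts => e'; apply: (@conjg_inj _ s); rewrite e' conjgE mulKg.
Qed.

Lemma inv_word (c : seq W) : all (mem S) c -> (#|N (\prod_(x <- c) x)%g| <= size c)%N.
Proof.
elim: c => [|s c IH] /=; first by rewrite big_nil inv1 cards0.
case/andP=> Ss Sc; rewrite big_cons.
set w := (\prod_(x <- c) x)%g.
have /subset_leq_card/leq_trans -> // : N (s * w)%g \subset s |: [set t ^ s^-1 | t in N w]%g%SET.
  apply/fintype.subsetP => t it; have Tt := inv_refl it.
  move: it; rewrite in_invM // inv_simple // finset.in_set1 in_setU1.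
  have [//|ts /= tw] := eqVneq t s.
  by apply/imsetP; exists (t ^ s)%g; rewrite ?conjgK.
rewrite cardsU1; apply: leq_trans (leq_add (leq_b1 _) (leq_imset_card _ _)) _.
by rewrite add1n ltnS IH.
Qed.

Lemma simple_sq s : s \in S -> (s * s = 1)%g.
Proof. by move=> /(@simple_order _ C) s2; have := expg_order s; rewrite s2. Qed.

(** The strong exchange condition. If [t] is the first letter [s], that letter is deleted; otherwise
    [t * s = s * t ^ s], and [t ^ s] is an inversion of the remaining word. *)
Lemma exchange (K : {set W}) c t : K \subset S -> all (mem K) c ->
  t \in N (\prod_(x <- c) x)%g ->
  exists2 c', all (mem K) c' /\ (size c').+1 = size c &
    (t * \prod_(x <- c) x = \prod_(x <- c') x)%g.
Proof.
move=> /fintype.subsetP KS; elim: c t => [|s c IH] t /=.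
  by rewrite big_nil inv1 finset.in_set0.
case/andP=> Ks Kc; rewrite big_cons => it; have Tt := inv_refl it.
have Ss := KS s Ks; have s2 := simple_sq Ss.
move: it; rewrite in_invM // inv_simple // finset.in_set1; have [->|ts /=] := eqVneq t s.
  by exists c; rewrite ?mulgA ?s2 ?mul1g.
move=> /(IH _ Kc)[c' [Kc' <-] e]; exists (s :: c'); first by rewrite /= Ks Kc'.
by rewrite big_cons -e conjgE !mulgA mulgV mul1g.
Qed.

End Inversions.

(** Provides one step size for finitely many strict inequalities. The denominator has 1 added so
    that it cannot vanish. *)
Lemma common_scale (R : realType) (I : eqType) (l : seq I) (a b : I -> R) :
  (forall i, i \in l -> 0 < a i) ->
  exists2 e, 0 < e & forall i, i \in l -> e * `|b i| < a i.
Proof.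
elim: l => [|i l IH] a0; first by exists 1.
have [|e e0 el] := IH; first by move=> j jl; rewrite a0 // inE jl orbT.
have q0 : 0 < a i / (`|b i| + 1) by rewrite divr_gt0 ?a0 ?mem_head // ltr_wpDl.
exists (Num.min e (a i / (`|b i| + 1))); first by rewrite lt_min e0.
move=> j; rewrite inE => /predU1P[->|jl].
  apply: le_lt_trans (_ : a i / (`|b i| + 1) * `|b i| < _).
    by rewrite ler_wpM2r // ge_min lexx orbT.
  by rewrite -mulrA -ltr_pdivlMl ?a0 ?mem_head // mulVf ?gt_eqF ?a0 ?mem_head //
     mulrC ltr_pdivrMr ?mul1r ?ltrDl ?ltr_wpDl.
by apply: le_lt_trans (el j jl); rewrite ler_wpM2r // ge_min lexx.
Qed.

(** * Length, inversion sets and chambers *)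

Section LengthInversions.
Variables (W : finGroupType) (C : coxeter_system W) (R : realType) (n : nat).
Variables (rho : mx_representation R [set: W]%G n) (G : chamber_data C rho).
Local Notation V := 'cV[R]_n.
Local Notation T := (reflections rho).
Local Notation S := (simple C).
Local Notation N := (inversions G).
Local Notation h := (ht G).
Local Notation act := (vact rho).
Local Notation delta := (base G).
Implicit Types (s t u w x y z : W) (v p o e : V) (K : {set W}).

Lemma inv_out t w : t \notin T -> (t \in N w) = false.
Proof. by apply: contraNF; exact: inv_refl. Qed.

(** The word grows on the right, and each letter toggles one reflection [t]. If [t] is gained the
    letter is appended; if it is lost, [exchange] deletes a letter instead. Words over [K] are
    needed for parabolic subgroups. *)
Lemma reduced_word K w : K \subset S -> w \in <<K>>%g ->
  exists c, [/\ all (mem K) c, size c = #|N w| & w = (\prod_(x <- c) x)%g].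
Proof.
move=> KS; have sub c : all (mem K) c -> all (mem S) c.
  by apply: sub_all => x; exact: (fintype.subsetP KS).
case/gen_word => c + ->; elim/last_ind: c => [|c s IH].
  by exists [::]; rewrite big_nil inv1 cards0.
rewrite all_rcons => /andP[Ks /IH[c' [Kc' szc' ew]]].
set w' := (\prod_(x <- c) x)%g in szc' ew *.
have Ss : s \in S by exact: (fintype.subsetP KS).
rewrite big_rcons /= -/w'.
pose t := (s ^ w'^-1)%g.
have Tt : t \in T by rewrite (conj_reflection G) (simple_reflection G).
(* Turns right multiplication by the last letter into left multiplication by [t], the form that
   [exchange] handles. *)
have tw : (t * w' = w' * s)%g by rewrite /t conjgE invgK !mulgA mulgKV.
have NE x : x \in T -> (x \in N (w' * s)%g) = (x \in N w') (+) (x == t).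
  move=> Tx; rewrite in_invM // (inv_simple G Ss) finset.in_set1.
  by rewrite /t (can2_eq (conjgK w') (conjgKV w')).
have [tN|tN] := boolP (t \in N w').
  have [c2 [Kc2 sz2] e2] : exists2 c2, all (mem K) c2 /\ (size c2).+1 = size c' &
      (t * \prod_(x <- c') x = \prod_(x <- c2) x)%g.
    by apply: (exchange (G := G)) => //; rewrite -ew.
  exists c2; split=> //; last by rewrite -e2 -ew tw.
  apply: succn_inj; rewrite sz2 szc' (cardsD1 t) tN add1n; congr (_.+1).
  apply: eq_card => x; rewrite finset.in_setD1.
  case: (boolP (x \in T)) => [Tx|Tx]; last first.
    by rewrite !(inv_out _ Tx) andbF.
  by rewrite NE //; have [->|] := eqVneq x t; rewrite ?tN // addbF.
exists (rcons c' s); split; last by rewrite big_rcons -ew.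
  by rewrite all_rcons Kc' andbT.
rewrite size_rcons szc' -add1n.
have -> : N (w' * s)%g = (t |: N w')%SET; last by rewrite cardsU1 tN.
apply/finset.setP => x; rewrite finset.in_setU1.
case: (boolP (x \in T)) => [Tx|Tx]; last first.
  rewrite !(inv_out _ Tx) orbF.
  by apply/esym/negP => /eqP xt; rewrite xt Tt in Tx.
by rewrite NE //; have [->|] := eqVneq x t; rewrite ?(negPf tN) // addbF.
Qed.

Lemma word_has_word (c : seq W) : all (mem S) c -> has_word C (\prod_(x <- c) x)%g (size c).
Proof.
move=> Sc; apply/has_wordP; exists (fun i => tnth (in_tuple c) i).
  by move=> i; apply: (allP Sc); exact: mem_tnth.
by rewrite [RHS](big_nth 1%g) big_mkord; apply: eq_bigr => i _; rewrite (tnth_nth 1%g).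
Qed.

Lemma length_inv w : length C w = #|N w|.
Proof.
apply/eqP; rewrite eqn_leq; apply/andP; split.
  have [|c [Sc <- ->]] := reduced_word (subxx S) (w := w).
    by rewrite simple_gen finset.in_setT.
  exact/length_min/word_has_word.
have /has_wordP[c Sc cw] := length_word C w.
have Sc' : all (mem S) (codom c) by apply/allP => _ /codomP[i ->]; exact: Sc.
have := inv_word G Sc'; rewrite size_codom card_ord.
by rewrite big_map enumT cw.
Qed.

Lemma inv_eq0 w : N w = finset.set0 -> w = 1%g.
Proof. by move=> w0; apply: (@length_eq0 _ C); rewrite length_inv w0 cards0. Qed.

Lemma inversions_inj : injective N.
Proof.
move=> x y e; suff /inv_eq0 xy : N (x^-1 * y)%g = finset.set0.
  by rewrite -(mulKVg x y) xy mulg1.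
apply/finset.setP => t; rewrite finset.in_set0; apply/negP => it.
have Tt := inv_refl it; have Tt' : (t ^ x^-1)%g \in T by rewrite (conj_reflection G).
have := @in_invM _ _ _ _ _ G (t ^ x^-1)%g x (x^-1 * y)%g Tt'.
by rewrite mulKVg e conjgKV it; case: (_ \in _).
Qed.

(** [N y] is the symmetric difference of [N x] and a conjugate [B] of [N (x^-1 * y)]. So lengths add
    up exactly when [N x] and [B] are disjoint, which means that [N x] is contained in [N y]. *)
Lemma weak_leE x y : ((x : weak C) <= (y : weak C))%O = (N x \subset N y).
Proof.
rewrite /Order.le /= /weak_le !length_inv.
set w := (x^-1 * y)%g.
pose B : {set W} := [set t | (t ^ x)%g \in N w]%SET.
have cB : #|B| = #|N w|.
  rewrite -(card_preimset (N w) (@conjg_inj _ x)).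
  by apply: eq_card => t; rewrite !finset.inE.
have TB t : t \in B -> t \in T by rewrite finset.in_set => /inv_refl; rewrite (conj_reflection G).
have Ny t : t \in T -> (t \in N y) = (t \in N x) (+) (t \in B).
  by move=> Tt; rewrite -[y in LHS](mulKVg x) in_invM // [_ \in B]finset.in_set.
have e : #|N y| + (#|N x :&: B|)%SET.*2 = #|N x| + #|B|.
  have -> : N y = ((N x :\: B) :|: (B :\: N x))%SET.
    apply/finset.setP => t; rewrite finset.in_setU !finset.in_setD.
    case: (boolP (t \in T)) => [Tt|Tt]; last first.
      by rewrite !(inv_out _ Tt) (contraNF (@TB _) Tt) andbF.
    by rewrite Ny //; case: (t \in N x); case: (t \in B).
  rewrite cardsU; have -> : ((N x :\: B) :&: (B :\: N x) = finset.set0)%SET.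
    apply/finset.setP => t; rewrite finset.in_setI !finset.in_setD finset.in_set0.
    by case: (t \in N x); case: (t \in B).
  rewrite cards0 subn0 -(cardsID B (N x)) -(cardsID (N x) B) (finset.setIC B).
  by rewrite -addnn; lia.
rewrite -cB.
have -> : (#|N y| == #|N x| + #|B|)%N = (#|N x :&: B|%SET == 0)%N by lia.
rewrite cards_eq0; apply/eqP/fintype.subsetP => [d0 t Nt|sub].
  rewrite Ny ?(inv_refl Nt) // Nt /=; apply/negP => Bt.
  by move/finset.setP/(_ t): d0; rewrite finset.in_setI Nt Bt finset.in_set0.
apply/finset.setP => t; rewrite finset.in_setI finset.in_set0; apply/negP => /andP[Nt Bt].
by have := sub t Nt; rewrite Ny ?TB // Nt Bt.
Qed.

(* The [w] maximising [dot (w^-1 v) base] carries the base chamber to that of [v]. *)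
Lemma chamber_of v : (forall t, t \in T -> h t v != 0) ->
  exists w, N w = [set t in T | h t v < 0]%SET.
Proof.
move=> v0; pose F u := dot (act u^-1%g v) delta.
case: (@Order.TotalTheory.arg_maxP _ _ W 1%g xpredT F isT) => w _ wmax.
exists w; apply/finset.setP => t; rewrite finset.inE in_inv.
case: (boolP (t \in T)) => //= Tt.
set u := act w^-1%g v; have uv : v = act w u by rewrite vactVK.
have upos r : r \in T -> 0 < h r u.
  move=> Tr; have rn0 : h r u != 0.
    have := v0 (r ^ w^-1)%g; rewrite (conj_reflection G) uv => /(_ Tr).
    have [|c c0 ->] := @ht_vact _ _ _ _ _ G (r ^ w^-1)%g w; first by rewrite (conj_reflection G).
    by rewrite conjgKV mulf_eq0 negb_or => /andP[].
  rewrite lt_neqAle eq_sym rn0 /=.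
  (* Reflecting [u] by [r] changes the maximised product by a negative multiple of
     [h r u * h r delta], so [h r u] cannot be negative. *)
  have := wmax (w * r^-1)%g isT; rewrite /F invMg invgK vactM -/u.
  have [/dot_gt0 r0 /(_ u)] := pos_rootP G Tr.
  rewrite -[_ *m u]/(act r u) => ->; rewrite dotBl dotZl -/(h r u).
  have := ht_base G Tr; rewrite /ht (dotC delta) => d0.
  rewrite /= gerBl pmulr_lge0 // pmulr_lge0 ?invr_gt0 //.
  by rewrite pmulr_rge0.
have [c c0 e] := ht_vact G w Tt.
have Ttw : (t ^ w)%g \in T by rewrite (conj_reflection G).
have hu := upos _ Ttw; have hd := ht_base G Ttw.
rewrite uv !e; case: ifP => _; rewrite ?mulNr ?oppr_lt0.
  by rewrite !(pmulr_rgt0 _ c0) hu hd.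
by rewrite !(pmulr_rlt0 _ c0) !ltNge !ltW.
Qed.

(** Take the chamber of [o + eps *: e] for small positive [eps]: nonzero signs at [o] persist and
    [e] breaks the ties. This is the tool for building elements with prescribed inversions. *)
Lemma chamber_near o e : (forall t, t \in T -> h t e != 0) ->
  exists w, forall t, t \in T ->
    (t \in N w) = (h t o < 0) || (h t o == 0) && (h t e < 0).
Proof.
move=> e0.
have [t|eps eps0 small] := @common_scale R _ [seq t <- enum T | h t o != 0]
    (fun t => `|h t o|) (fun t => h t e).
  by rewrite mem_filter normr_gt0 => /andP[].
have hE t : h t (o + eps *: e) = h t o + eps * h t e by rewrite /ht dotDl dotZl.
have near0 t : t \in T -> h t o != 0 ->
    (h t (o + eps *: e) != 0) * ((h t (o + eps *: e) < 0) = (h t o < 0)).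
  move=> Tt ot0; have := small t; rewrite mem_filter ot0 mem_enum Tt hE => /(_ isT).
  have := ler_norm (eps * h t e); have := ler_norm (- (eps * h t e)).
  rewrite normrN normrM (gtr0_norm eps0).
  case: (ltrgt0P (h t o)) ot0 => // o0 _ ? ? ?.
    by split; [apply/eqP => ?; lra | apply/negbTE; rewrite -leNgt; lra].
  by split; [apply/eqP => ?; lra | rewrite -[_ = true]/(is_true _); lra].
have [|w ew] := chamber_of (v := o + eps *: e).
  move=> t Tt; have [ot0|/near0[] //] := eqVneq (h t o) 0.
  by rewrite hE ot0 add0r mulf_neq0 ?e0 ?gt_eqF.
exists w => t Tt; rewrite ew finset.in_set Tt /=.
have [ot0|ot0] := eqVneq (h t o) 0; last by rewrite near0 // orbF.
by rewrite hE ot0 ltxx add0r pmulr_rlt0.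
Qed.

(** * Parabolic subgroups and faces of chambers *)

Lemma gen_inversion K w t : K \subset S -> w \in <<K>>%g -> t \in N w -> t \in <<K>>%g.
Proof.
move=> /fintype.subsetP KS /gen_word[c + ->]; elim: c t => [|s c IH] t /=.
  by rewrite big_nil inv1 finset.in_set0.
case/andP=> Ks Kc; rewrite big_cons => it.
move: (it); rewrite in_invM ?(inv_refl it) // (inv_simple G (KS s Ks)) finset.in_set1.
have [->|_ /= /(IH _ Kc)] := eqVneq t s; first by rewrite mem_gen.
by rewrite groupJr // mem_gen.
Qed.

(** An orbit sum, hence fixed by the parabolic subgroup. For [K] contained in [S] it is a relative
    interior point of the face of the base chamber on the walls of [K]. *)
Definition face_dir K : V := \sum_(w in <<K>>%g) act w delta.

Lemma face_dir0 K t : t \in T -> t \in <<K>>%g -> h t (face_dir K) = 0.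
Proof.
move=> Tt Kt; suff fixed : act t (face_dir K) = face_dir K.
  have := ht_reflection G (face_dir K) Tt; rewrite fixed => e; lra.
rewrite /face_dir vact_sum [RHS](reindex_inj (mulgI t)) /=.
by apply: eq_big => [w|w _]; rewrite ?groupMl // vactM.
Qed.

Lemma face_dir_gt0 K t : K \subset S -> t \in T -> t \notin <<K>>%g ->
  0 < h t (face_dir K).
Proof.
move=> KS Tt Kt; rewrite /ht /face_dir dot_suml -/(h t _).
have pos w : w \in <<K>>%g -> 0 < h t (act w delta).
  by move=> Kw; rewrite (ht_vact_base G w Tt).2; apply: contra Kt; exact: gen_inversion.
rewrite (bigD1 1%g) ?group1 //= ltr_pwDl ?pos ?group1 //.
by apply: sumr_ge0 => w /andP[/pos/ltW].
Qed.

(** Stands in for the fact that positive roots of a parabolic subgroup are nonnegative combinations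
    of those of [K]. Let [w] maximise [dot (act w v) delta]. If a reduced word of [w] ended in [s],
    the root of the inversion [s ^ w^-1] would be negative at [act w v] because [h s v] is positive,
    against maximality. *)
Lemma fundamental_chamber K v : K \subset S ->
  (forall s, s \in K -> 0 < h s v) ->
  (forall t, t \in T -> t \in <<K>>%g -> h t v != 0) ->
  forall t, t \in T -> t \in <<K>>%g -> 0 < h t v.
Proof.
move=> KS Kv v0; pose F u := dot (act u v) delta.
case: (@Order.TotalTheory.arg_maxP _ _ W 1%g (fun w => w \in <<K>>%g) F (group1 _)) => w Kw wmax.
set u := act w v.
have upos r : r \in T -> r \in <<K>>%g -> 0 <= h r u.
  move=> Tr Kr; have := wmax (r * w)%g; rewrite groupM // => /(_ isT).
  rewrite /F vactM -/u; have [/dot_gt0 r0 /(_ u)] := pos_rootP G Tr.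
  rewrite -[_ *m u]/(act r u) => ->; rewrite dotBl dotZl -/(h r u).
  have := ht_base G Tr; rewrite /ht (dotC delta) => d0.
  by rewrite /= gerBl pmulr_lge0 // pmulr_lge0 ?invr_gt0 // pmulr_rge0.
suff w1 : w = 1%g.
  by move=> t Tt Kt; have := upos t Tt Kt; rewrite /u w1 vact1 le_eqVlt eq_sym (negPf (v0 t Tt Kt)).
have [c [Kc szc ew]] := reduced_word KS Kw.
case/lastP: c => [|c s] in Kc szc ew; first by rewrite ew big_nil.
move: Kc; rewrite all_rcons => /andP[Ks Kc].
have Ss : s \in S by exact: (fintype.subsetP KS).
move: ew; rewrite big_rcons /=; set w' := (\prod_(x <- c) x)%g => ew.
have Nw' : (#|N w'| < #|N w|)%N.
  rewrite -szc size_rcons ltnS; apply: inv_word.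
  by apply: sub_all Kc => x; exact: (fintype.subsetP KS).
pose t := (s ^ w^-1)%g; have Tt : t \in T by rewrite (conj_reflection G) (simple_reflection G).
have [tN|tN] := boolP (t \in N w).
  have Kt : t \in <<K>>%g by rewrite groupJr ?groupV // mem_gen.
  have := upos t Tt Kt; have [d d0 ->] := ht_vact G w Tt.
  by rewrite tN conjgKV mulNr oppr_ge0 pmulr_rle0 // leNgt Kv.
suff /subset_leq_card : N w \subset N w' by rewrite leqNgt Nw'.
apply/fintype.subsetP => x Nx; have Tx := inv_refl Nx.
have -> : w' = (w * s)%g by rewrite ew -mulgA (simple_sq Ss) mulg1.
rewrite in_invM // Nx (inv_simple G Ss) finset.in_set1 /= -(conjgKV w s) -/t.
by rewrite (inj_eq (@conjg_inj _ w)); apply: contra tN => /eqP <-.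
Qed.

(* A point in the relative interior of the face of the chamber of [z] that lies
   in the walls indexed by [K]. *)
Definition face_point z K : V := act z (face_dir K).

Lemma face_point0 z K t : t \in T -> (t ^ z)%g \in <<K>>%g -> h t (face_point z K) = 0.
Proof.
move=> Tt Kt; have [c c0 ->] := ht_vact G z Tt.
by rewrite face_dir0 ?(conj_reflection G) // mulr0.
Qed.

Lemma face_point_sign z K t : K \subset S -> t \in T -> (t ^ z)%g \notin <<K>>%g ->
  (h t (face_point z K) < 0) = (t \in N z) /\
  (0 < h t (face_point z K)) = (t \notin N z).
Proof.
move=> KS Tt Kt; have [c c0 ->] := ht_vact G z Tt.
have pos : 0 < h (t ^ z)%g (face_dir K) by rewrite face_dir_gt0 ?(conj_reflection G).
case: ifP => _; rewrite ?mulNr ?oppr_lt0 ?oppr_gt0 !(pmulr_rlt0 _ c0) !(pmulr_rgt0 _ c0).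
  by rewrite pos ltNge ltW.
by rewrite pos ltNge ltW.
Qed.

(** [fundamental_chamber] applies to the image under [z^-1] of [delta] or [- delta], with the sign
    chosen by [b] so that the roots of [K] are positive there. *)
Lemma face_uniform z K b : K \subset S ->
  (forall s, s \in K -> ((s ^ z^-1)%g \in N z) = b) ->
  forall t, t \in T -> (t ^ z)%g \in <<K>>%g -> (t \in N z) = b.
Proof.
move=> KS Kb t Tt Kt.
pose e : R := if b then -1 else 1; pose v := act z^-1%g (e *: delta).
have zv : act z v = e *: delta by rewrite vactVK.
have hv r : h r (act z v) = e * h r delta by rewrite zv /ht dotZl.
have e0 : e != 0 by rewrite /e; case: ifP; rewrite ?oppr_eq0 oner_eq0.
have : 0 < h (t ^ z)%g v.
  apply: (fundamental_chamber KS) => [s Ks|r Tr _||] //; last by rewrite (conj_reflection G).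
    have Tr : (s ^ z^-1)%g \in T.
      by rewrite (conj_reflection G) (simple_reflection G) ?(fintype.subsetP KS).
    have := hv (s ^ z^-1)%g; have [c c0 ->] := ht_vact G z Tr.
    have := ht_base G Tr; rewrite conjgKV Kb // /e; case: (b) => d0 hv_; nra.
  have Tr' : (r ^ z^-1)%g \in T by rewrite (conj_reflection G).
  have := hv (r ^ z^-1)%g; have [c c0 ->] := ht_vact G z Tr'.
  rewrite conjgKV; have [-> /esym/eqP|//] := eqVneq (h r v) 0.
  by rewrite mulr0 mulf_eq0 (negPf e0) gt_eqF ?ht_base.
move=> pos; have := hv t; have [c c0 ->] := ht_vact G z Tt.
have := ht_base G Tt; rewrite /e; case: (t \in N z); case: (b) => // d0 hv_; exfalso; clear zv; nra.
Qed.

(** [fundamental_chamber] applies to the image of [- act u delta] under [z^-1]: the roots of [K] are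
    positive there because [z] inverts the corresponding walls and [u] does not. *)
Lemma face_avoid z K u : K \subset S ->
  (forall s, s \in K -> (s ^ z^-1)%g \in N z) ->
  (forall s, s \in K -> (s ^ z^-1)%g \notin N u) ->
  forall t, t \in T -> (t ^ z)%g \in <<K>>%g -> t \notin N u.
Proof.
move=> KS Kz Ku t Tt Kt.
have Nz r : r \in T -> (r ^ z)%g \in <<K>>%g -> r \in N z.
  by apply: (face_uniform (b := true)).
pose v := act z^-1%g (- act u delta).
have hv r : h r (act z v) = - h r (act u delta) by rewrite vactVK /ht dotNl.
have : 0 < h (t ^ z)%g v.
  apply: (fundamental_chamber KS) => [s Ks|r Tr _||] //; last by rewrite (conj_reflection G).
    have Tr : (s ^ z^-1)%g \in T.
      by rewrite (conj_reflection G) (simple_reflection G) ?(fintype.subsetP KS).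
    have := hv (s ^ z^-1)%g; have [c c0 ->] := ht_vact G z Tr.
    have [_ ] := ht_vact_base G u Tr; rewrite Ku // Kz // conjgKV => d0 hv'; nra.
  have Tr' : (r ^ z^-1)%g \in T by rewrite (conj_reflection G).
  have := hv (r ^ z^-1)%g; have [c c0 ->] := ht_vact G z Tr'.
  rewrite conjgKV; have [-> /esym/eqP|//] := eqVneq (h r v) 0.
  rewrite mulr0 oppr_eq0 => /eqP u0; have [] := ht_vact_base G u Tr'.
  by rewrite u0 ltxx => <-.
move=> pos; have := hv t; have [c c0 ->] := ht_vact G z Tt.
rewrite Nz // -(ht_vact_base G u Tt).2 => hv'; nra.
Qed.

End LengthInversions.

(** * The weak order *)

Section WeakLattice.
Variables (W : finGroupType) (C : coxeter_system W) (R : realType) (n : nat).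
Variables (rho : mx_representation R [set: W]%G n) (G : chamber_data C rho).
Local Notation V := 'cV[R]_n.
Local Notation T := (reflections rho).
Local Notation S := (simple C).
Local Notation N := (inversions G).
Local Notation h := (ht G).
Local Notation act := (vact rho).
Local Notation delta := (base G).
Implicit Types (q r s t u w x y z j m : W) (v p o e : V) (K : {set W}).

Lemma in_inv_mul_simple z s x : s \in S -> x \in T ->
  (x \in N (z * s)%g) = (x \in N z) (+) (x == (s ^ z^-1)%g).
Proof.
move=> Ss Tx; rewrite in_invM // (inv_simple G Ss) finset.in_set1.
by rewrite (can2_eq (conjgK z) (conjgKV z)).
Qed.

(** A weak order cover, labelled by the reflection [t] whose hyperplane separates the two
    chambers. *)
Definition covers z t z' : Prop := t \notin N z' /\ N z = (t |: N z')%SET.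

Lemma covers_in z t z' : covers z t z' -> t \in N z.
Proof. by case=> _ ->; rewrite finset.setU11. Qed.

Lemma covers_sub z t z' : covers z t z' -> N z' \subset N z.
Proof. by case=> _ ->; exact: finset.subsetUr. Qed.

Lemma covers_mem z t z' q : covers z t z' -> (q \in N z') = (q \in N z) && (q != t).
Proof.
case=> tz' ->; rewrite finset.in_setU1.
by have [->|] := eqVneq q t; rewrite ?(negPf tz') //= andbT.
Qed.

Lemma simple_covers z s : s \in S -> (s ^ z^-1)%g \in N z ->
  covers z (s ^ z^-1)%g (z * s)%g.
Proof.
move=> Ss tz; have Tt := inv_refl tz; split.
  by rewrite (in_inv_mul_simple z Ss Tt) tz eqxx.
apply/finset.setP => x; rewrite finset.in_setU1.
have [->|xt] := eqVneq x (s ^ z^-1)%g; first by rewrite tz.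
case: (boolP (x \in T)) => Tx; last by rewrite !(inv_out _ _ Tx).
by rewrite (in_inv_mul_simple z Ss Tx) (negPf xt) addbF.
Qed.

Lemma weak_card x y : (N x \subset N y) = (#|N y| == #|N x| + #|N (x^-1 * y)%g|)%N.
Proof. by rewrite -weak_leE /Order.le /= /weak_le !(length_inv G). Qed.

Lemma covers_simple z t z' : covers z t z' ->
  exists s, [/\ s \in S, z' = (z * s)%g & t = (s ^ z^-1)%g].
Proof.
move=> zz'; have := covers_sub zz'; rewrite weak_card => /eqP card_z.
pose s := (z'^-1 * z)%g.
have s1 : length C s = 1%N.
  rewrite (length_inv G); have [tz' Nz] := zz'.
  by move: card_z; rewrite Nz cardsU1 tz' -/s; lia.
have Ss : s \in S.
  have := length_word C s; rewrite s1 => /has_wordP[c Sc <-].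
  by rewrite big_ord1.
have zs : z = (z' * s)%g by rewrite mulKVg.
exists s; split=> //; first by rewrite zs -mulgA (simple_sq Ss) mulg1.
have Tt := inv_refl (covers_in zz').
have := covers_in zz'; rewrite {1}zs (in_inv_mul_simple z' Ss Tt) (negPf zz'.1) /= => /eqP ->.
by rewrite zs invMg conjgM; congr (_ ^ _)%g; rewrite conjgE invgK -mulgA mulgV mulg1.
Qed.

(** Drop the last letter of a reduced word of [x^-1 * y]; counting inversions shows that the result
    still lies above [x]. *)
Lemma lower_cover x y : N x \subset N y -> x != y ->
  exists t y', covers y t y' /\ N x \subset N y'.
Proof.
move=> xy x_y; have := xy; rewrite weak_card => /eqP card_y.
pose w := (x^-1 * y)%g.
have [|c [Sc szc ew]] := reduced_word G (subxx S) (w := w).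
  by rewrite simple_gen finset.in_setT.
case/lastP: c => [|c s] in Sc szc ew.
  by rewrite big_nil in ew; rewrite -(mulKVg x y) -/w ew mulg1 eqxx in x_y.
move: Sc; rewrite all_rcons => /andP[Ss Sc].
move: ew; rewrite big_rcons /=; set w' := (\prod_(x <- c) x)%g => ew.
have ys : (y * s = x * w')%g by rewrite -(mulKVg x y) -/w ew -!mulgA (simple_sq Ss) mulg1.
have Nw' : (#|N w'| <= size c)%N by exact: inv_word.
have Nys : (#|N (y * s)%g| <= #|N x| + #|N w'|)%N.
  by rewrite ys -!(length_inv G) lengthM.
rewrite size_rcons -/w in szc; rewrite -/w -szc in card_y.
have [ty|ty] := boolP ((s ^ y^-1)%g \in N y); last first.
  suff /subset_leq_card : N y \subset N (y * s)%g by lia.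
  apply/fintype.subsetP => q Nq; rewrite (in_inv_mul_simple y Ss (inv_refl Nq)) Nq /=.
  by apply: contra ty => /eqP <-.
have ys_cov := simple_covers Ss ty.
exists (s ^ y^-1)%g, (y * s)%g; split=> //.
rewrite weak_card ys mulKg -ys; apply/eqP.
by have [tys Ny] := ys_cov; move: card_y; rewrite Ny cardsU1 tys; lia.
Qed.

Lemma longest_ex : exists w0, N w0 = T.
Proof.
have [|w0 ew] := @chamber_of _ _ _ _ _ G (- delta).
  by move=> t Tt; rewrite /ht dotNl oppr_eq0 gt_eqF ?base_gt0.
exists w0; rewrite ew; apply/finset.setP => t; rewrite finset.in_set.
by case: (boolP (t \in T)) => //= Tt; rewrite /ht dotNl oppr_lt0 base_gt0.
Qed.

(** Right multiplication by the longest element complements inversion sets. This order-reversing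
    involution derives upper statements from lower ones. *)
Fact opp_key u : {w | forall t, (t \in N w) = (t \in T) && (t \notin N u)}.
Proof.
have [w0 Nw0] := cid longest_ex; exists (u * w0)%g => t.
case: (boolP (t \in T)) => Tt; last exact: inv_out.
by rewrite in_invM // Nw0 (conj_reflection G) Tt addbT.
Qed.

Definition opp u : W := sval (opp_key u).

Lemma in_opp u t : (t \in N (opp u)) = (t \in T) && (t \notin N u).
Proof. exact: svalP (opp_key u) t. Qed.

Lemma oppK : involutive opp.
Proof.
move=> u; apply: (@inversions_inj _ _ _ _ _ G); apply/finset.setP => t; rewrite !in_opp.
by case: (boolP (t \in T)) => Tt; rewrite ?negbK // (inv_out _ _ Tt).
Qed.

Lemma opp_sub u w : (N (opp u) \subset N (opp w)) = (N w \subset N u).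
Proof.
have imp x y : N x \subset N y -> N (opp y) \subset N (opp x).
  move=> /fintype.subsetP xy; apply/fintype.subsetP => t; rewrite !in_opp.
  by case/andP=> -> /=; apply: contra; exact: xy.
by apply/idP/idP => [/imp|/imp//]; rewrite !oppK.
Qed.

Lemma opp_covers z t z' : covers z t z' -> covers (opp z') t (opp z).
Proof.
move=> zz'; have Tt := inv_refl (covers_in zz').
split; first by rewrite in_opp Tt (covers_in zz').
apply/finset.setP => q; rewrite finset.in_setU1 !in_opp (covers_mem q zz').
by have [->|] := eqVneq q t; rewrite ?Tt ?andbF ?andbT.
Qed.

Lemma upper_cover x y : N x \subset N y -> x != y ->
  exists t x', covers x' t x /\ N x' \subset N y.
Proof.
rewrite -opp_sub => xy x_y; have [|t [x' [xx' yx']]] := lower_cover xy.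
  by rewrite (inj_eq (can_inj oppK)) eq_sym.
by exists t, (opp x'); rewrite -opp_sub oppK -[x]oppK; split=> //; exact: opp_covers.
Qed.

Definition descents z : {set W} := [set s in S | (s ^ z^-1)%g \in N z]%SET.

Lemma descentsP z s : reflect (s \in S /\ (s ^ z^-1)%g \in N z) (s \in descents z).
Proof. by rewrite finset.in_set; exact: andP. Qed.

Lemma descents_sub z K : K \subset descents z ->
  K \subset S /\ forall s, s \in K -> (s ^ z^-1)%g \in N z.
Proof.
move=> /fintype.subsetP Kz; split=> [|s /Kz /descentsP[]//].
by apply/fintype.subsetP => s /Kz /descentsP[].
Qed.

Lemma face_inv z K t : K \subset descents z -> t \in T -> (t ^ z)%g \in <<K>>%g -> t \in N z.
Proof. by move=> /descents_sub[KS Kz] Tt Kt; exact: (face_uniform (b := true)) Kt. Qed.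

(** [b] is the chamber opposite to [z] across the face of [K], where all inversions belonging to the
    face are undone. *)
Lemma face_bottom z K : K \subset descents z ->
  exists b, forall q, (q \in N b) = (q \in N z) && ((q ^ z)%g \notin <<K>>%g).
Proof.
move=> Kz; have [KS _] := descents_sub Kz.
have [t Tt|b bE] := @chamber_near _ _ _ _ _ G (face_point G z K) (- act z delta).
  by rewrite /ht dotNl oppr_eq0 -/(h t _) ht_vact_base_neq0.
exists b => q; case: (boolP (q \in T)) => Tq; last by rewrite !(inv_out _ _ Tq).
rewrite bE //; have [Kq|Kq] := boolP ((q ^ z)%g \in <<K>>%g).
  rewrite (face_point0 G Tq Kq) ltxx eqxx andbF /= /ht dotNl oppr_lt0 -/(h q _).
  by rewrite (ht_vact_base G z Tq).2 (face_inv Kz Tq Kq).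
have [-> +] := face_point_sign G KS Tq Kq; rewrite andbT.
by case: (q \in N z) => //= p0; rewrite gt_eqF.
Qed.

(** The chamber opposite to [z'] across the face retains exactly [t] among the reflections of the
    face, so it is one step above the bottom. *)
Lemma face_flat z t z' K : K \subset descents z -> covers z t z' -> (t ^ z)%g \in <<K>>%g ->
  exists f, forall q, (q \in N f) = (q \in N z) && (((q ^ z)%g \notin <<K>>%g) || (q == t)).
Proof.
move=> Kz zz' Kt; have [KS _] := descents_sub Kz.
have [r Tr|b bE] := @chamber_near _ _ _ _ _ G (face_point G z K) (- act z' delta).
  by rewrite /ht dotNl oppr_eq0 -/(h r _) ht_vact_base_neq0.
exists b => q; case: (boolP (q \in T)) => Tq; last by rewrite !(inv_out _ _ Tq).
rewrite bE //; have [Kq|Kq] := boolP ((q ^ z)%g \in <<K>>%g).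
  rewrite (face_point0 G Tq Kq) ltxx eqxx /= /ht dotNl oppr_lt0 -/(h q _).
  by rewrite (ht_vact_base G z' Tq).2 (covers_mem q zz') (face_inv Kz Tq Kq) /= negbK.
have [-> +] := face_point_sign G KS Tq Kq; rewrite andbT.
by case: (q \in N z) => //= p0; rewrite gt_eqF.
Qed.

(** * Extremal elements for a prescribed inversion *)

Definition is_min z t j : Prop := [/\ t \in N j, N j \subset N z &
  forall u, N u \subset N z -> t \in N u -> N j \subset N u].

Definition is_max z t m : Prop := [/\ t \notin N m, N z \subset N m &
  forall u, N z \subset N u -> t \notin N u -> N u \subset N m].

(** Choose [u'] with fewest inversions; a down-step across any other hyperplane would keep [t]. *)
Lemma minimal_with t u : t \in N u ->
  exists u' u'', [/\ N u' \subset N u, covers u' t u'' &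
    forall w, N w \subset N u' -> t \in N w -> w = u'].
Proof.
move=> tu; pose P w := (N w \subset N u) && (t \in N w).
have Pu : P u by rewrite /P subxx.
have [u' /andP[u'u tu'] min_u'] := arg_minnP (fun w => #|N w|) Pu.
have minE w : N w \subset N u' -> t \in N w -> w = u'.
  move=> wu' tw; apply: (@inversions_inj _ _ _ _ _ G); apply/eqP.
  by rewrite eqEcard wu' min_u' // /P tw (fintype.subset_trans wu').
have [| |t1 [u'' [cu _]]] := @lower_cover 1%g u'.
- by rewrite inv1 finset.sub0set.
- by apply: contraTneq tu' => <-; rewrite inv1 finset.in_set0.
exists u', u''; split=> //; suff -> : t = t1 by [].
apply/eqP; apply: contraT => tt1.
have u''E : u'' = u' by apply: minE; rewrite ?(covers_sub cu) // (covers_mem t cu) tu'.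
by have := cu.1; rewrite u''E (covers_in cu).
Qed.

(* Let [s] be the descent of [z] for [t].  If it is not the only one, the flat element
   [f] of the face of all descents is shorter than [z], and its least element is the
   one for [z]: an element of [N z] containing [t] and minimal for this misses some
   other descent [r], so it lies below the flat element of the rank 2 face of [s] and
   [r], which is above [f]. *)
Lemma min_ex z t z' : covers z t z' -> exists j, is_min z t j.
Proof.
have [k] := ubnP #|N z|; elim: k z z' => // k IH z z' /ltnSE le_k zz'.
have [s0 [Ss0 z's0 ts0]] := covers_simple zz'.
have ts0' : (t ^ z)%g = s0 by rewrite ts0 conjgKV.
have Ks0 : s0 \in descents z by apply/descentsP; rewrite -ts0 (covers_in zz').
case: (boolP [exists r, (r \in descents z) && (r != s0)]); last first.
  (* With a single descent, everything strictly below [z] is below [z'] and misses [t], so [z]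
     itself is least. *)
  rewrite negb_exists => /forallP only; exists z; split=> //; first exact: covers_in zz'.
  move=> u uz tu; have [->//|u_z] := eqVneq u z.
  have [t1 [z1 [zz1 uz1]]] := lower_cover uz u_z.
  have [s [Ss z1s t1s]] := covers_simple zz1.
  have := only s; rewrite negb_and negbK => /orP[/descentsP[]|/eqP ss0].
    by split=> //; rewrite -t1s (covers_in zz1).
  have := fintype.subsetP uz1 t tu; rewrite (covers_mem t zz1) t1s ss0 -ts0 eqxx andbF.
  by [].
move=> /existsP[r0 /andP[Kr0 r0s0]].
have genK r (K : {set W}) : r \in K -> r \in <<K>>%g by exact: mem_gen.
have [|||f fE] := @face_flat z t z' (descents z) => //; first by rewrite ts0' genK.
have [|b bE] := @face_bottom z (descents z) => //.
have tz := covers_in zz'.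
have ft : covers f t b.
  split; first by rewrite bE ts0' genK // andbF.
  apply/finset.setP => q; rewrite finset.in_setU1 fE bE.
  by have [->|] := eqVneq q t; rewrite ?tz ?orbT // orbF.
have fz : N f \subset N z by apply/fintype.subsetP => q; rewrite fE => /andP[].
have small u : N u \subset N z -> (exists r, (r \in descents z) && ((r ^ z^-1)%g \notin N u)) ->
    (#|N u| < k)%N.
  move=> uz [r /andP[/descentsP[_ rz] ru]]; apply: leq_trans le_k; apply: proper_card.
  by rewrite properE uz; apply/fintype.subsetPn; exists (r ^ z^-1)%g.
have [|j [tj jf minj]] := IH f b _ ft.
  apply: small => //; exists r0; rewrite Kr0 fE conjgKV genK //= ts0.
  by rewrite (inj_eq (@conjg_inj _ _)) (negPf r0s0) andbF.
exists j; split=> //; first exact: fintype.subset_trans jf fz.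
move=> u uz tu; have [u' [u'' [u'u cu min_u']]] := minimal_with tu.
have u'z : N u' \subset N z by exact: fintype.subset_trans u'u uz.
apply: fintype.subset_trans u'u.
have tu' := covers_in cu.
(* Otherwise minimality of [u'] gives [f = z], although [f] misses the wall of the descent [r0]. *)
have u'_z : u' != z.
  apply: contraTneq Kr0 => u'z_; apply/negP => Kr0.
  have fu' : f = u' by apply: min_u'; rewrite ?u'z_ // (covers_in ft).
  have := fE (r0 ^ z^-1)%g; rewrite fu' u'z_ conjgKV genK // ts0.
  rewrite (inj_eq (@conjg_inj _ _)) (negPf r0s0) andbF.
  by case/descentsP: Kr0 => _ ->.
have [t1 [z1 [zz1 uz1]]] := lower_cover u'z u'_z.
have [r [Sr z1r t1r]] := covers_simple zz1.
have Kr : r \in descents z by apply/descentsP; rewrite -t1r (covers_in zz1).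
have t1u' : t1 \notin N u'.
  by apply: contra zz1.1; exact: (fintype.subsetP uz1).
have rs0 : r != s0 by apply: contraNneq t1u' => rs0; rewrite t1r rs0 -ts0.
pose K2 : {set W} := [set s0; r]%SET.
have K2z : K2 \subset descents z.
  by apply/fintype.subsetP => s; rewrite finset.in_set2 => /orP[]/eqP->.
have [KS2 Kz2] := descents_sub K2z.
have s0K2 : s0 \in K2 by rewrite finset.set21.
have rK2 : r \in K2 by rewrite finset.set22.
have [|||g gE] := @face_flat z t z' K2 => //; first by rewrite ts0' genK.
have [|b2 b2E] := @face_bottom z K2 => //.
have gt : covers g t b2.
  split; first by rewrite b2E ts0' genK // andbF.
  apply/finset.setP => q; rewrite finset.in_setU1 gE b2E.
  by have [->|] := eqVneq q t; rewrite ?tz ?orbT // orbF.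
have gz : N g \subset N z by apply/fintype.subsetP => q; rewrite gE => /andP[].
have [|j2 [tj2 jg minj2]] := IH g b2 _ gt.
  apply: small => //; exists r; rewrite Kr gE conjgKV genK //= ts0.
  by rewrite (inj_eq (@conjg_inj _ _)) (negPf rs0) andbF.
have fg : N f \subset N g.
  apply/fintype.subsetP => q; rewrite fE gE => /andP[-> /=]; case/orP => [q1|->]; last exact: orbT.
  by rewrite (contra _ q1) // => q2; exact: (fintype.subsetP (genS K2z)).
have u'g : N u' \subset N g.
  apply/fintype.subsetP => q qu'; rewrite gE (fintype.subsetP u'z) //=.
  (* [u''] misses the walls of both [s0] and [r], hence every reflection of the rank 2 face by
     [face_avoid]; so [t] is the only one in [N u']. *)
  have [//|Kq /=] := boolP ((q ^ z)%g \notin <<K2>>%g); rewrite negbK in Kq.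
  apply: contraT => qt.
  have : q \notin N u''; last by rewrite (covers_mem q cu) qu' qt.
  apply: (face_avoid KS2 Kz2) Kq; last exact: inv_refl qu'.
  move=> s; rewrite finset.in_set2 => /orP[]/eqP->; first by rewrite -ts0 cu.1.
  by rewrite -t1r; apply: contra t1u'; exact/fintype.subsetP/(covers_sub cu).
(* [j2] is below [u'], and also below [f] because [f] is below [g]; hence [j] is below [j2]. *)
apply: fintype.subset_trans (minj2 _ u'g tu').
apply: minj => //; apply: minj2 => //; exact: covers_in ft.
Qed.

Lemma is_min_opp z t j : t \in T -> is_min (opp z) t (opp j) -> is_max z t j.
Proof.
move=> Tt [tj jz minj]; split.
- by move: tj; rewrite in_opp Tt.
- by rewrite -opp_sub.
- by move=> u zu tu; rewrite -opp_sub; apply: minj; rewrite ?opp_sub ?in_opp ?Tt.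
Qed.

Lemma max_ex z t z' : covers z' t z -> exists m, is_max z t m.
Proof.
move=> zz'; have Tt := inv_refl (covers_in zz').
have [j jP] := min_ex (opp_covers zz'); exists (opp j); apply: is_min_opp => //.
by rewrite oppK.
Qed.

Lemma is_max_opp z t m : t \in T -> is_max z t m -> is_min (opp z) t (opp m).
Proof.
move=> Tt [tm zm maxm]; split.
- by rewrite in_opp Tt.
- by rewrite opp_sub.
- move=> u uz tu; rewrite -[u]oppK opp_sub; apply: maxm; first by rewrite -opp_sub oppK.
  by rewrite in_opp tu andbF.
Qed.

(** A down-step from [j] across another hyperplane would keep [t], against minimality. This makes
    [j] join-irreducible. *)
Lemma is_min_cover z t j : is_min z t j ->
  (exists j', covers j t j') /\ forall t1 j1, covers j t1 j1 -> t1 = t.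
Proof.
move=> [tj jz minj]; have only t1 j1 : covers j t1 j1 -> t1 = t.
  move=> cj; apply/eqP; apply: contraT; rewrite eq_sym => tt1.
  have j1z : N j1 \subset N z by exact: fintype.subset_trans (covers_sub cj) jz.
  have : N j \subset N j1 by apply: minj => //; rewrite (covers_mem t cj) tj.
  by move/fintype.subsetP/(_ _ (covers_in cj)); rewrite (negPf cj.1).
split=> //.
have [| |t1 [j' [cj _]]] := @lower_cover 1%g j.
- by rewrite inv1 finset.sub0set.
- by apply: contraTneq tj => <-; rewrite inv1 finset.in_set0.
- by exists j'; rewrite -(only _ _ cj).
Qed.

Lemma is_max_cover z t m : t \in T -> is_max z t m -> exists m', covers m' t m.
Proof.
move=> Tt /(is_max_opp Tt) /is_min_cover[[m' cm] _]; exists (opp m').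
by rewrite -[m]oppK; exact: opp_covers.
Qed.

(** * Meets and joins *)

(** Induction on a common upper bound [z]. If [x] and [y] lie below lower covers [z1] and [z2], then
    by [face_avoid] every common lower bound lies below the bottom [b] of the face on the two walls.
    The meet of [x], [b] and [y] is taken in two steps, below [z1] and then below [z2]. *)
Lemma meet_ex x y : exists m, forall u, (N u \subset N m) = (N u \subset N x) && (N u \subset N y).
Proof.
have [w0 Nw0] := longest_ex.
have sub0 u : N u \subset N w0 by rewrite Nw0; apply/fintype.subsetP => q; exact: inv_refl.
move: (sub0 x) (sub0 y); have [k] := ubnP #|N w0|; move: w0 {Nw0 sub0} => z.
elim: k z x y => // k IH z x y /ltnSE le_k xz yz.
have [xz_|x_z] := eqVneq x z.
  exists y => u; rewrite xz_; case: (boolP (N u \subset N y)); rewrite ?andbF ?andbT //.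
  by move/fintype.subset_trans/(_ yz) => ->.
have [yz_|y_z] := eqVneq y z.
  exists x => u; rewrite yz_; case: (boolP (N u \subset N x)) => //=.
  by move/fintype.subset_trans/(_ xz) => ->.
have [t1 [z1 [zz1 xz1]]] := lower_cover xz x_z.
have [t2 [z2 [zz2 yz2]]] := lower_cover yz y_z.
have [s1 [Ss1 z1s t1s]] := covers_simple zz1.
have [s2 [Ss2 z2s t2s]] := covers_simple zz2.
pose K : {set W} := [set s1; s2]%SET.
have Kz : K \subset descents z.
  apply/fintype.subsetP => s; rewrite finset.in_set2 => /orP[]/eqP->; apply/descentsP.
    by rewrite -t1s (covers_in zz1).
  by rewrite -t2s (covers_in zz2).
have [KS Kz'] := descents_sub Kz.
have [b bE] := face_bottom Kz.
have small z3 t3 : covers z t3 z3 -> (#|N z3| < k)%N.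
  by move=> [t3z Nz]; move: le_k; rewrite Nz cardsU1 t3z.
have bz i t3 s3 z3 : i = z3 -> covers z t3 z3 -> t3 = (s3 ^ z^-1)%g -> s3 \in K -> N b \subset N i.
  move=> -> c3 t3s Ks3; apply/fintype.subsetP => q; rewrite bE (covers_mem q c3).
  case/andP=> -> /=; apply: contra => /eqP->.
  by rewrite t3s conjgKV mem_gen.
have bz1 : N b \subset N z1 by apply: bz zz1 t1s _; rewrite ?finset.set21.
have bz2 : N b \subset N z2 by apply: bz zz2 t2s _; rewrite ?finset.set22.
have [m1 m1E] := IH z1 x b (small _ _ zz1) xz1 bz1.
have [|m2 m2E] := IH z2 m1 y (small _ _ zz2) _ yz2.
  by have := m1E m1; rewrite subxx => /esym/andP[_ /fintype.subset_trans]; apply.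
exists m2 => u; rewrite m2E m1E.
case: (boolP (N u \subset N x)) => //= ux; 
case: (boolP (N u \subset N y)) => uy; rewrite ?andbF ?andbT //.
apply/fintype.subsetP => q qu; rewrite bE.
rewrite (fintype.subsetP (fintype.subset_trans ux xz)) //=; apply/negP => Kq.
have : q \notin N u; last by rewrite qu.
apply: (face_avoid KS Kz') Kq; last exact: inv_refl qu.
move=> s; rewrite finset.in_set2 => /orP[]/eqP->.
  by rewrite -t1s; apply: contra zz1.1; exact/fintype.subsetP/(fintype.subset_trans ux).
by rewrite -t2s; apply: contra zz2.1; exact/fintype.subsetP/(fintype.subset_trans uy).
Qed.

Lemma inf_ex (l : seq W) : exists m, forall u,
  (N u \subset N m) = all (fun a => N u \subset N a) l.
Proof.
elim: l => [|a l [m mE]].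
  have [w0 Nw0] := longest_ex; exists w0 => u.
  by rewrite Nw0; apply/fintype.subsetP => q; exact: inv_refl.
by have [m' m'E] := meet_ex a m; exists m' => u; rewrite m'E mE.
Qed.

Lemma sup_ex (l : seq W) : exists m, forall u,
  (N m \subset N u) = all (fun a => N a \subset N u) l.
Proof.
have [m mE] := inf_ex [seq opp a | a <- l]; exists (opp m) => u.
rewrite -{1}(oppK u) opp_sub mE all_map; apply: eq_all => a /=.
by rewrite opp_sub.
Qed.

End WeakLattice.

(** * Shards *)

Section Shards.
Variables (W : finGroupType) (C : coxeter_system W) (R : realType) (n : nat).
Variables (rho : mx_representation R [set: W]%G n) (G : chamber_data C rho).
Local Notation V := 'cV[R]_n.
Local Notation T := (reflections rho).
Local Notation S := (simple C).
Local Notation N := (inversions G).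
Local Notation h := (ht G).
Local Notation act := (vact rho).
Local Notation delta := (base G).
Local Notation covers := (covers G).
Local Notation is_min := (is_min G).
Local Notation is_max := (is_max G).
Local Notation opp := (opp G).
Local Notation descents := (descents G).
Implicit Types (q r s t u w x y z a b j m : W) (v p o e : V) (K : {set W}).

(** Algebraic counterpart of [cuts]. By [cuts_cut] and [cut_cuts], both notions remove the same
    subspaces from the hyperplane of [t]. *)
Definition cut t a : Prop := exists b c d,
  [/\ [/\ a \in T, b \in T, a != t & b != t], 0 < c, 0 < d &
      pos_root G t = c *: pos_root G a + d *: pos_root G b].

(** When [w] covers an element across [t], these inequalities describe the shard that contains the
    corresponding facet of [w]. *)
Definition in_shard w t p : Prop := h t p = 0 /\
  forall a, cut t a -> (a \in N w -> h a p <= 0) /\ (a \notin N w -> 0 <= h a p).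

Lemma cut_ht t a b c d v : pos_root G t = c *: pos_root G a + d *: pos_root G b ->
  h t v = c * h a v + d * h b v.
Proof. by rewrite /ht => ->; rewrite dotDr !dotZr. Qed.

(** If [a] and [b] were both inverted, [t] would be inverted at [z']; if neither were, [t] would not
    be inverted at [z]. *)
Lemma cut_split z t z' a b c d : covers z t z' ->
  [/\ a \in T, b \in T, a != t & b != t] -> 0 < c -> 0 < d ->
  pos_root G t = c *: pos_root G a + d *: pos_root G b ->
  (a \in N z) = (b \notin N z).
Proof.
move=> zz' [Ta Tb at_ bt] c0 d0 /cut_ht e.
have Tt := inv_refl (covers_in zz').
have [za|za] := boolP (a \in N z); have [zb|zb] := boolP (b \in N z) => //.
  have : h t (act z' delta) < 0.
    rewrite e; have := ht_vact_base G z' Ta; have := ht_vact_base G z' Tb.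
    rewrite !(covers_mem _ zz') za zb at_ bt /= => -[b0 _] [a0 _]; nra.
  by rewrite (ht_vact_base G z' Tt).1 (negPf zz'.1).
have : h t (act z delta) > 0.
  rewrite e; have := ht_vact_base G z Ta; have := ht_vact_base G z Tb.
  rewrite (negPf za) (negPf zb) /= => -[_ b0] [_ a0]; nra.
by rewrite (ht_vact_base G z Tt).2 (covers_in zz').
Qed.

(** By [cut_split] each of [x] and [z] inverts exactly one reflection of a cutting pair, so the
    inclusion is an equality on it. Thus both facets lie in one shard. *)
Lemma cut_transfer x x' z z' t a : covers x t x' -> covers z t z' ->
  N x \subset N z -> cut t a -> (a \in N x) = (a \in N z).
Proof.
move=> xx' zz' /fintype.subsetP xz [b [c [d [ab c0 d0 e]]]].
apply/idP/idP => [/xz //|]; rewrite (cut_split zz' ab c0 d0 e) (cut_split xx' ab c0 d0 e).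
by apply: contra => /xz.
Qed.

Definition facet_point z t : V := act z (wall_point G (t ^ z)%g).

Lemma facet_point0 z t z' : covers z t z' -> h t (facet_point z t) = 0.
Proof.
move=> zz'; have Tt := inv_refl (covers_in zz').
have [c c0 ->] := ht_vact G z Tt; have [s [Ss _ ->]] := covers_simple zz'.
by rewrite conjgKV /ht wall_point0 // mulr0.
Qed.

Lemma facet_point_sign z t z' r : covers z t z' -> r \in T -> r != t ->
  (h r (facet_point z t) < 0) = (r \in N z) /\ (0 < h r (facet_point z t)) = (r \notin N z).
Proof.
move=> zz' Tr rt; have [c c0 ->] := ht_vact G z Tr.
have [s [Ss _ ts]] := covers_simple zz'.
have pos : 0 < h (r ^ z)%g (wall_point G (t ^ z)%g).
  rewrite wall_point_gt0 ?(conj_reflection G) //; first by rewrite ts conjgKV.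
  by rewrite (inj_eq (@conjg_inj _ z)).
case: ifP => _; rewrite ?mulNr ?oppr_lt0 ?oppr_gt0 !(pmulr_rlt0 _ c0) !(pmulr_rgt0 _ c0).
  by rewrite pos ltNge ltW.
by rewrite pos ltNge ltW.
Qed.

(* If [t] sends another positive root [a_r] to a negative one, then [a_t] is a
   positive combination of [a_r] and [- t a_r]. *)
Lemma reflection_cut t r : t \in T -> r \in N t -> r != t -> cut t r.
Proof.
move=> Tt Nr rt; have Tr := inv_refl Nr.
have [_ tE] := pos_rootP G Tt.
have [c c0 rE] := ht_vact G t Tr; rewrite Nr in rE.
pose k := 2 * dot (pos_root G t) (pos_root G r) / dot (pos_root G t) (pos_root G t).
have key v : k * h t v = h r v + c * h (r ^ t)%g v.
  have := rE v; rewrite {1}/ht /vact tE dotBl dotZl -/(h r v) -/(h t v) => e.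
  have -> : k * h t v = 2 * h t v / dot (pos_root G t) (pos_root G t) *
    dot (pos_root G t) (pos_root G r) by rewrite /k; ring.
  lra.
have Trt : (r ^ t)%g \in T by rewrite (conj_reflection G).
have k0 : 0 < k.
  have := ht_base G Tt; have := ht_base G Tr; have := ht_base G Trt; have := key delta; nra.
exists (r ^ t)%g, k^-1, (k^-1 * c); split.
- split=> //; apply: contra rt => /eqP rt; apply/eqP; apply: (@conjg_inj _ t).
  by rewrite rt conjgE mulKg.
- by rewrite invr_gt0.
- by rewrite mulr_gt0 ?invr_gt0.
- apply: dot_ext => v; rewrite dotDr !dotZr -!/(h _ v).
  by rewrite -mulrA -mulrDr -key mulKf ?gt_eqF.
Qed.

(** The chamber around [p] farthest from the base: [p] is perturbed towards [- delta]. The nearest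
    one, [open_chamber], uses [delta]. *)
Lemma closed_chamber p : exists w, forall r, (r \in N w) = (r \in T) && (h r p <= 0).
Proof.
have [t Tt|w wE] := @chamber_near _ _ _ _ _ G p (- delta).
  by rewrite /ht dotNl oppr_eq0 gt_eqF ?base_gt0.
exists w => r; case: (boolP (r \in T)) => Tr /=; last exact: inv_out.
by rewrite wE // /ht dotNl oppr_lt0 base_gt0 // andbT orbC -le_eqVlt.
Qed.

Lemma open_chamber p : exists w, forall r, (r \in N w) = (r \in T) && (h r p < 0).
Proof.
have [t Tt|w wE] := @chamber_near _ _ _ _ _ G p delta.
  by rewrite gt_eqF ?ht_base.
exists w => r; case: (boolP (r \in T)) => Tr /=; last exact: inv_out.
by rewrite wE // (ltNge (h r delta)) ltW ?ht_base // andbF orbF.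
Qed.

(** By [reflection_cut], among the reflections through [o] only [t] is an inversion of [t].
    Perturbing [o] along [- act t delta] and [act t delta] thus gives the neighbours across [t] of
    the farthest and of the nearest chamber around [o]. *)
Lemma indecomposable_chambers t o : t \in T -> h t o = 0 ->
  (forall r, cut t r -> h r o != 0) ->
  exists y y' f, [/\ covers y t y',
    forall r, (r \in N y) = (r \in T) && (h r o <= 0) &
    forall r, (r \in N f) = (r \in T) && ((h r o < 0) || (r == t))].
Proof.
move=> Tt ot0 nocut.
have Nt r : h r o = 0 -> r \in N t = (r == t).
  move=> or0; apply/idP/eqP => [Nr|->]; last first.
    by rewrite in_inv Tt ht_reflection // oppr_lt0 ht_base.
  by apply/eqP; apply: contraT => /(reflection_cut Tt Nr)/nocut; rewrite or0 eqxx.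
have [y yE] := closed_chamber o.
have [r Tr|y' y'E] := @chamber_near _ _ _ _ _ G o (- act t delta).
  by rewrite /ht dotNl oppr_eq0 -/(h r _) ht_vact_base_neq0.
have [r Tr|f fE] := @chamber_near _ _ _ _ _ G o (act t delta).
  by rewrite ht_vact_base_neq0.
have y't r : r \in T -> (r \in N y') = (h r o <= 0) && (r != t).
  move=> Tr; rewrite y'E //; have [or0|or0] := eqVneq (h r o) 0.
    rewrite or0 ltxx lexx /= /ht dotNl oppr_lt0 -/(h r _).
    by rewrite (ht_vact_base G t Tr).2 Nt.
  rewrite orbF lt_neqAle or0 /=; have [rt|] := eqVneq r t; rewrite ?andbT //.
  by rewrite rt ot0 eqxx in or0.
exists y, y', f; split=> //; last first.
  move=> r; case: (boolP (r \in T)) => Tr /=; last exact: inv_out.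
  rewrite fE //; have [or0|or0] := eqVneq (h r o) 0.
    by rewrite or0 ltxx /= (ht_vact_base G t Tr).1 Nt.
  rewrite orbF; have [rt|] := eqVneq r t; rewrite ?orbF //.
  by rewrite rt ot0 eqxx in or0.
split; first by rewrite y't // eqxx andbF.
apply/finset.setP => r; rewrite finset.in_setU1 yE.
have [->|rt] := eqVneq r t; first by rewrite Tt ot0 lexx.
case: (boolP (r \in T)) => Tr /=; last by rewrite (inv_out _ _ Tr).
by rewrite y't // rt andbT.
Qed.

(* The least element [j] whose inversion set contains [t] stays weakly below
   every point of the shard: otherwise follow the segment from the facet of [j]
   to a bad point [p] until it first meets a hyperplane of [N j]. *)
Lemma shard_min z t z' j p a : covers z t z' -> is_min z t j -> in_shard z t p ->
  a \in N j -> h a p <= 0.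
Proof.
move=> zz' jP [tp0 shp] ja; rewrite leNgt; apply/negP => ap0.
have [[j' jj'] _] := is_min_cover jP; have [tj jz minj] := jP.
have Tt := inv_refl tj.
pose q := facet_point j t; have tq0 : h t q = 0 by exact: facet_point0 jj'.
have qE r : r \in T -> r != t -> (h r q < 0) = (r \in N j) /\ (0 < h r q) = (r \notin N j).
  exact: facet_point_sign jj'.
pose bad r := (r \in N j) && (0 < h r p).
(* The parameter at which the segment from [q] to [p] crosses the hyperplane of [r]; [i] is a first
   bad crossing. *)
pose lam r := - h r q / (h r p - h r q).
have bad_a : bad a by rewrite /bad ja ap0.
case: (@Order.TotalTheory.arg_minP _ _ W a bad lam bad_a) => i /andP[ji ip0] min_i.
have it : i != t by apply: contraTneq ip0 => ->; rewrite tp0 ltxx.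
have iq0 : h i q < 0 by rewrite (qE _ (inv_refl ji) it).1.
pose l := lam i; pose o := q + l *: (p - q).
have oE r : h r o = (1 - l) * h r q + l * h r p.
  by rewrite /o /ht dotDl dotZl dotBl; ring.
have den r : 0 < h r p -> h r q < 0 -> 0 < h r p - h r q by move=> *; lra.
have l0 : 0 < l by rewrite /l /lam divr_gt0 ?den ?oppr_gt0.
have l1 : l < 1 by rewrite /l /lam ltr_pdivrMr ?den // mul1r; lra.
have io0 : h i o = 0.
  rewrite oE /l /lam; field; rewrite gt_eqF // den //.
have jo r : r \in N j -> h r o <= 0.
  move=> jr; have [->|rt] := eqVneq r t; first by rewrite oE tq0 tp0 !mulr0 addr0.
  have rq0 : h r q < 0 by rewrite (qE _ (inv_refl jr) rt).1.
  have [rp0|rp0] := lerP (h r p) 0; first by rewrite oE; nra.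
  have : l <= lam r by apply: min_i; rewrite /bad jr rp0.
  rewrite /lam ler_pdivlMr ?den // oE => le_l; lra.
(* Cutting roots have strict sign at [q] and no opposite sign at [p], and [l < 1], so they stay
   nonzero at [o]. *)
have nocut r : cut t r -> h r o != 0.
  move=> cr; have [neg pos] := shp r cr; have Tr : r \in T by case: cr => ? [? [? [[]]]].
  have rt : r != t by case: cr => ? [? [? [[]]]].
  have [q1 q2] := qE r Tr rt; have tr := cut_transfer jj' zz' jz cr.
  rewrite oE; have [jr|jr] := boolP (r \in N j).
    rewrite jr in q1; rewrite -tr jr in neg; have := neg isT => ?.
    by rewrite lt_eqF //; nra.
  rewrite jr in q2; rewrite -tr jr in pos; have := pos isT => ?.
  by rewrite gt_eqF //; nra.
have ot0 : h t o = 0 by rewrite oE tq0 tp0 !mulr0 addr0.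
have [y [y' [f [yy' yE fE]]]] := indecomposable_chambers Tt ot0 nocut.
have [j1 [tj1 j1y minj1]] := min_ex yy'.
have j1j : N j1 \subset N j.
  apply: minj1 => //; apply/fintype.subsetP => r jr.
  by rewrite yE (inv_refl jr) jo.
have jj1 : N j \subset N j1 by apply: minj => //; exact: fintype.subset_trans j1j jz.
(* [j] equals [j1], which lies below [f]. But [i] vanishes at [o] and differs from [t], so [N f]
   misses it. *)
have j1f : N j1 \subset N f.
  apply: minj1; last by rewrite fE Tt eqxx orbT.
  apply/fintype.subsetP => r; rewrite fE yE => /andP[-> /=] /orP[/ltW //|/eqP->].
  by rewrite ot0.
have := fintype.subsetP (fintype.subset_trans jj1 j1f) i ji.
by rewrite fE io0 ltxx (negPf it) andbF.
Qed.

(** The image of [shard_min] under [opp] and the reversal of [p] to [- p]. *)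
Lemma shard_max z t z' m p a : covers z t z' -> is_max z' t m -> in_shard z t p ->
  a \in T -> a \notin N m -> 0 <= h a p.
Proof.
move=> zz' mP [tp0 shp] Ta ma; have Tt := inv_refl (covers_in zz').
have hN r : h r (- p) = - h r p by rewrite /ht dotNl.
rewrite -oppr_le0 -hN; apply: (shard_min (opp_covers zz') (is_max_opp Tt mP)).
  split=> [|r cr]; first by rewrite hN tp0 oppr0.
  have [neg pos] := shp r cr; have Tr : r \in T by case: cr => ? [? [? [[]]]].
  have rt : r != t by case: cr => ? [? [? [[]]]].
  rewrite hN oppr_le0 oppr_ge0 in_opp Tr (covers_mem r zz') rt andbT /= negbK.
  by split.
by rewrite in_opp Ta.
Qed.

(** * Points in all lower shards, and the extended kappa map *)

Definition in_shards y p : Prop := forall t y', covers y t y' -> in_shard y t p.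

(** The meet of the maxima, encoded by its universal property; without lower covers [k] is the top
    element. *)
Definition ext_kappa y k : Prop := forall u, N u \subset N k <->
  forall t y' m, covers y t y' -> is_max y' t m -> N u \subset N m.

(** If the meet [m] of [y] and [u] were not [y], it would lie below some [y'] and miss [t], yet it
    lies above the least element attached to [t]. *)
Lemma join_min y u :
  (forall t y' j, covers y t y' -> is_min y t j -> N j \subset N u) -> N y \subset N u.
Proof.
move=> ju; have [m mE] := meet_ex G y u; have := mE m; rewrite subxx => /esym/andP[my mu].
have [<-//|m_y] := eqVneq m y.
have [t [y' [yy' my']]] := lower_cover my m_y.
have [j jP] := min_ex yy'; have [tj jy _] := jP.
have : N j \subset N m by rewrite mE jy (ju _ _ _ yy' jP).
move/fintype.subset_trans/(_ my')/fintype.subsetP/(_ t tj).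
by rewrite (negPf yy'.1).
Qed.

(** By [shard_min], the farthest chamber around [p] lies above all the least elements of [y], hence
    above their join [y]. *)
Lemma in_shards_sub y p a : in_shards y p -> a \in N y -> h a p <= 0.
Proof.
move=> yp ya; have [w wE] := closed_chamber p.
suff : N y \subset N w by move/fintype.subsetP/(_ a ya); rewrite wE => /andP[].
apply: join_min => t y' j yy' jP; apply/fintype.subsetP => r jr.
by rewrite wE (inv_refl jr) (shard_min yy' jP (yp _ _ yy') jr).
Qed.

Lemma in_shards_sup y k p a : ext_kappa y k -> in_shards y p -> a \in T ->
  h a p < 0 -> a \in N k.
Proof.
move=> kP yp Ta ap; have [w wE] := open_chamber p.
suff : N w \subset N k by move/fintype.subsetP; apply; rewrite wE Ta.
apply/kP => t y' m yy' mP; apply/fintype.subsetP => r; rewrite wE => /andP[Tr].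
by apply: contraLR => mr; rewrite -leNgt (shard_max yy' mP (yp _ _ yy')).
Qed.

Lemma ext_kappa_notin y k t y' : ext_kappa y k -> covers y t y' -> t \notin N k.
Proof.
move=> kP yy'; have [m mP] := max_ex yy'; have [tm _ _] := mP.
by apply: contra tm; apply/fintype.subsetP; apply: (kP k).1 yy' mP; rewrite subxx.
Qed.

(** The bounds force [h t p = 0], since [t] is in [N x] but not in [N k]. If [a] is not inverted,
    its partner [b] is; as the two terms cancel at [p], [h a p] is nonnegative. *)
Lemma in_shards_of_bounds x k p : ext_kappa x k ->
  (forall a, a \in N x -> h a p <= 0) ->
  (forall a, a \in T -> h a p < 0 -> a \in N k) -> in_shards x p.
Proof.
move=> kP low up t x' xx'; have Tt := inv_refl (covers_in xx').
have tp0 : h t p = 0.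
  apply/eqP; rewrite eq_le (low _ (covers_in xx')) leNgt /=.
  by apply: contra (ext_kappa_notin kP xx') => /(up _ Tt).
split=> // a [b [c [d [ab c0 d0 e]]]]; split=> [/low //|xa].
have xb : b \in N x.
  by move: xa; rewrite (cut_split xx' ab c0 d0 e) negbK.
have := low _ xb; have := cut_ht p e; rewrite tp0 => e0 bp.
have : c * h a p >= 0 by nra.
by rewrite pmulr_rge0.
Qed.

(** The witness is a relative interior point of the face where all lower facets of [y] meet. *)
Lemma lower_face y : exists2 p, in_shards y p & forall a, a \in T -> h a p <= 0 -> a \in N y.
Proof.
have Kz := subxx (descents y); have [KS _] := descents_sub Kz.
have sgn a : a \in T -> (a \in N y -> h a (face_point G y (descents y)) <= 0) /\
    (h a (face_point G y (descents y)) <= 0 -> a \in N y).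
  move=> Ta; have [Ka|Ka] := boolP ((a ^ y)%g \in <<descents y>>%g).
    by rewrite (face_point0 G Ta Ka) (face_inv Kz Ta Ka).
  have [neg pos] := face_point_sign G KS Ta Ka.
  by rewrite leNgt pos negbK.
exists (face_point G y (descents y)) => [t y' yy'|a Ta]; last exact: (sgn a Ta).2.
have Tt := inv_refl (covers_in yy').
split=> [|a cuta].
  apply: face_point0 => //; apply: mem_gen; have [s [Ss _ ts]] := covers_simple yy'.
  by rewrite ts conjgKV; apply/descentsP; rewrite -ts (covers_in yy').
have Ta : a \in T by case: cuta => ? [? [? [[]]]].
split; first exact: (sgn a Ta).1.
by apply: contraR; rewrite -ltNge => /ltW; exact: (sgn a Ta).2.
Qed.

(** The flat element of the face of all descents contains [t] but no other descent wall, and [j]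
    lies below it. *)
Lemma min_other y t y' t2 y2 j : covers y t y' -> covers y t2 y2 -> t2 != t ->
  is_min y t j -> t2 \notin N j.
Proof.
move=> yy' yy2 t2t [tj jy minj].
have K r z : covers y r z -> (r ^ y)%g \in <<descents y>>%g.
  move=> yz; apply: mem_gen; have [s [Ss _ ts]] := covers_simple yz.
  by rewrite ts conjgKV; apply/descentsP; rewrite -ts (covers_in yz).
have [|||f fE] := @face_flat _ _ _ _ _ G y t y' (descents y) => //; first exact: K yy'.
have : N j \subset N f.
  apply: minj; last by rewrite fE eqxx orbT (covers_in yy').
  by apply/fintype.subsetP => q; rewrite fE => /andP[].
move/fintype.subsetP/(_ t2) => jf; apply/negP => /jf.
by rewrite fE (K _ _ yy2) (negPf t2t) andbF.
Qed.

Lemma covers_inj z t x y : covers z t x -> covers z t y -> x = y.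
Proof.
move=> zx zy; apply: (@inversions_inj _ _ _ _ _ G); apply/finset.setP => q.
by rewrite (covers_mem q zx) (covers_mem q zy).
Qed.

Lemma is_max_inj z t m1 m2 : is_max z t m1 -> is_max z t m2 -> m1 = m2.
Proof.
move=> [t1 z1 max1] [t2 z2 max2]; apply: (@inversions_inj _ _ _ _ _ G).
by apply/eqP; rewrite finset.eqEsubset (max1 m2) // (max2 m1).
Qed.

(** Let [u] be the join of [k] and [j]; it lies below [m'] and below the maxima for the other
    labels. An upper cover of [k] below [u] not labelled [t] would avoid [t], so it would lie below
    every maximum and hence below [k]. *)
Lemma ext_kappa_upper y k t y' : ext_kappa y k -> covers y t y' -> exists c, covers c t k.
Proof.
move=> kP yy'; have Tt := inv_refl (covers_in yy').
have [j jP] := min_ex yy'; have [tj jy minj] := jP.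
have [m mP] := max_ex yy'; have [tm y'm maxm] := mP.
have [m' mm'] := is_max_cover Tt mP.
have tk := ext_kappa_notin kP yy'.
have km := (kP k).1 (subxx _).
have [u uE] := sup_ex G [:: k; j].
have := uE u; rewrite subxx /= andbT => /esym/andP[ku ju].
have um2 t2 y2 m2 : covers y t2 y2 -> is_max y2 t2 m2 -> t2 != t -> N u \subset N m2.
  move=> yy2 m2P t2t; rewrite uE /= andbT (km _ _ _ yy2 m2P) /=.
  have [_ y2m2 _] := m2P; apply: fintype.subset_trans y2m2.
  apply/fintype.subsetP => q jq; rewrite (covers_mem q yy2) (fintype.subsetP jy) //=.
  by apply: contraTneq jq => ->; exact: min_other yy' yy2 t2t jP.
have um' : N u \subset N m'.
  rewrite uE /= andbT (fintype.subset_trans (km _ _ _ yy' mP) (covers_sub mm')) /=.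
  apply/fintype.subsetP => q jq; have [_ ->] := mm'; rewrite finset.in_setU1.
  have [//|qt /=] := eqVneq q t; apply: (fintype.subsetP y'm).
  by rewrite (covers_mem q yy') (fintype.subsetP jy).
have k_u : k != u by apply: contraNneq tk => ->; exact: (fintype.subsetP ju).
have [t1 [c [ck cu]]] := upper_cover ku k_u.
have [t1t|t1t] := eqVneq t1 t; first by exists c; rewrite -t1t.
have : N c \subset N k.
  apply/kP => t2 y2 m2 yy2 m2P; have [t2t|t2t] := eqVneq t2 t; last first.
    exact: fintype.subset_trans cu (um2 _ _ _ yy2 m2P t2t).
  rewrite t2t in yy2 m2P; rewrite (covers_inj yy2 yy') in m2P.
  rewrite (is_max_inj m2P mP); apply/fintype.subsetP => q cq.
  rewrite (covers_mem q mm') (fintype.subsetP (fintype.subset_trans cu um')) //=.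
  apply: contraNneq tk => qt; move: cq; have [_ ->] := ck; rewrite finset.in_setU1 qt.
  by rewrite eq_sym (negPf t1t).
by move/fintype.subsetP/(_ _ (covers_in ck)); rewrite (negPf ck.1).
Qed.

(** The witness is a relative interior point of the face of [k] on those walls that carry the labels
    of lower covers of [y]; none of these labels is an inversion of [k]. *)
Lemma upper_face y k : ext_kappa y k ->
  exists2 p, in_shards y p & forall a, a \in N k -> h a p < 0.
Proof.
move=> kP; pose K : {set W} := [set s in S | `[< exists y', covers y (s ^ k^-1)%g y' >]]%SET.
have KS : K \subset S by apply/fintype.subsetP => s; rewrite finset.in_set => /andP[].
have Kk s : s \in K -> ((s ^ k^-1)%g \in N k) = false.
  rewrite finset.in_set => /andP[_ /asboolP[y' yy']]; apply/negbTE.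
  exact: ext_kappa_notin kP yy'.
have low := face_uniform KS Kk.
exists (face_point G k K) => [t y' yy'|a ka]; last first.
  have Ta := inv_refl ka; rewrite (face_point_sign G KS Ta _).1 //.
  by apply/negP => /(low a Ta); rewrite ka.
have Tt := inv_refl (covers_in yy').
have [c ck] := ext_kappa_upper kP yy'.
split=> [|a cuta].
  apply: face_point0 => //; apply: mem_gen.
  have [s [Ss kc ts]] := covers_simple ck.
  have tk : (t ^ k)%g = s by rewrite kc ts -conjgM mulKg conjgE mulKg.
  rewrite tk finset.in_set Ss /=; apply/asboolP; exists y'.
  by rewrite -tk conjgK.
have [m mP] := max_ex yy'; have [m' mm'] := is_max_cover Tt mP.
have Ta : a \in T by case: cuta => ? [? [? [[]]]].
have at_ : a != t by case: cuta => ? [? [? [[]]]].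
(* Comparing [y] and the upper cover of [k] with [m'] shows that [y] and [k] invert the same cutting
   reflections. *)
have up z z' : covers z t z' -> N z' \subset N m -> (a \in N z) = (a \in N m').
  move=> zz' z'm; apply: (cut_transfer zz' mm' _ cuta).
  by have [_ ->] := zz'; have [_ ->] := mm'; exact: finset.setUS.
have ak : (a \in N y) = (a \in N k).
  have [_ y'm _] := mP.
  rewrite (up _ _ yy' y'm) -(up _ _ ck ((kP k).1 (subxx _) _ _ _ yy' mP)).
  by rewrite (covers_mem a ck) at_ andbT.
rewrite ak; have [Ka|Ka] := boolP ((a ^ k)%g \in <<K>>%g).
  by rewrite (face_point0 G Ta Ka) lexx.
have [neg pos] := face_point_sign G KS Ta Ka.
by split=> ka; apply: ltW; rewrite ?neg ?pos.
Qed.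

Theorem in_shards_sub_iff x y kx ky : ext_kappa x kx -> ext_kappa y ky ->
  (forall p, in_shards y p -> in_shards x p) <-> N x \subset N y /\ N ky \subset N kx.
Proof.
move=> xP yP; split=> [sub|[xy kyx] p yp].
  have [p yp pE] := lower_face y; have [p' yp' p'E] := upper_face yP.
  split; apply/fintype.subsetP => a ia; have Ta := inv_refl ia.
    by apply: pE => //; exact: in_shards_sub (sub _ yp) ia.
  by apply: (in_shards_sup xP (sub _ yp') Ta); exact: p'E.
apply: (in_shards_of_bounds xP) => [a xa|a Ta ap].
  by apply: in_shards_sub yp _; exact: (fintype.subsetP xy).
by apply: (fintype.subsetP kyx); exact: in_shards_sup yP yp Ta ap.
Qed.

Lemma ext_kappa_ex y : exists k, ext_kappa y k.
Proof.
pose P m := `[< exists t y', covers y t y' /\ is_max y' t m >].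
have [k kE] := inf_ex G [seq m <- enum W | P m]; exists k => u; rewrite kE.
split=> [/allP um t y' m yy' mP|um].
  by apply: um; rewrite mem_filter mem_enum andbT; apply/asboolP; exists t, y'.
apply/allP => m; rewrite mem_filter => /andP[/asboolP[t [y' [yy' mP]]] _].
exact: um yy' mP.
Qed.

End Shards.

(** * The kappa order *)

Section KappaOrderWeak.
Variables (W : finGroupType) (C : coxeter_system W) (R : realType) (n : nat).
Variables (rho : mx_representation R [set: W]%G n) (G : chamber_data C rho).
Local Notation T := (reflections rho).
Local Notation N := (inversions G).
Local Notation covers := (covers G).
Local Notation is_min := (is_min G).
Local Notation is_max := (is_max G).
Local Notation L := (weak C).
Implicit Types (x y u j k m c : weak C) (t : W) (A B : set (weak C)).

Lemma leE x y : (x <= y)%O = (N x \subset N y).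
Proof. exact: weak_leE. Qed.

Lemma covers_lt z t z' : covers z t z' -> ((z' : L) < (z : L))%O.
Proof.
move=> zz'; rewrite lt_neqAle leE (covers_sub zz') andbT.
by apply: contraTneq (covers_in zz') => <-; exact: zz'.1.
Qed.

Lemma lt_cover x y : (x < y)%O -> exists t y', covers y t y' /\ (x <= (y' : L))%O.
Proof.
rewrite lt_neqAle leE => /andP[x_y xy].
by have [t [y' [yy' xy']]] := lower_cover xy x_y; exists t, y'; rewrite leE.
Qed.

Definition canonical_joinands x : set L := [set j | exists t x', covers x t x' /\ is_min x t j].

Lemma min_lt x t j j' c : is_min x t j -> covers j t j' -> (c < j)%O -> (c <= (j' : L))%O.
Proof.
move=> jP jj' /lt_cover[t1 [j1 [jj1 cj1]]].
have [_ only] := is_min_cover jP; have t1t := only _ _ jj1; rewrite t1t in jj1.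
by rewrite (covers_inj jj' jj1).
Qed.

Lemma min_lower_covers x t j j' : is_min x t j -> covers j t j' ->
  lower_covers j = [set (j' : L)].
Proof.
move=> jP jj'; have j'j := covers_lt jj'; apply/seteqP; split=> c /=.
  move=> [cj none]; have := min_lt jP jj' cj; rewrite le_eqVlt => /predU1P[//|cj'].
  by case: none; exists j'.
move=> ->; split=> // -[z [j'z zj]].
by have /le_gtF := min_lt jP jj' zj; rewrite j'z.
Qed.

Lemma infimums_cover t j j' k : covers j t j' ->
  infimums [set j; k] (j' : L) <-> N j' \subset N k /\ t \notin N k.
Proof.
move=> jj'; have j'j := covers_lt jj'.
split=> [[lb glb]|[j'k tk]].
  have j'k : ((j' : L) <= k)%O by apply: lb; right.
  split; first by rewrite -leE.
  apply/negP => tk; have /le_gtF : (j <= (j' : L))%O; last by rewrite j'j.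
  apply: glb => _ [->|->]; first exact: lexx.
  by rewrite leE; have [_ ->] := jj'; rewrite finset.subUset finset.sub1set tk -leE.
split=> [_ [->|->]|u lb]; first exact: ltW.
  by rewrite leE.
have uj : (u <= j)%O by apply: lb; left.
have uk : (u <= k)%O by apply: lb; right.
rewrite leE in uj; rewrite leE in uk; rewrite leE.
apply/fintype.subsetP => q uq; rewrite (covers_mem q jj') (fintype.subsetP uj) //=.
by apply: contraNneq tk => <-; exact: (fintype.subsetP uk).
Qed.

Lemma is_kappa_max x t j j' k : is_min x t j -> covers j t j' ->
  is_kappa j k <-> is_max j' t k.
Proof.
move=> jP jj'; have low := min_lower_covers jP jj'.
have infE := infimums_cover _ jj'.
split=> [[jl]|[tk j'k maxk]].
  rewrite low => /seteqP[/(_ j' erefl) /= <- _] /= [/infE[j'k tk] maxk].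
  by split=> // u j'u tu; rewrite -leE; apply: maxk; exact/infE.
exists (j' : L) => //; split=> /=; first exact/infE.
by move=> u /infE[j'u tu]; rewrite leE; exact: maxk.
Qed.

(** The greatest element above [j'] avoiding [t] is already above [x'], since [x'] lies above [j']
    and avoids [t]. *)
Lemma is_max_min x x' t j j' k : covers x t x' -> is_min x t j -> covers j t j' ->
  is_max j' t k <-> is_max x' t k.
Proof.
move=> xx' [tj jx minj] jj'.
have j'x' : N j' \subset N x'.
  apply/fintype.subsetP => q; rewrite (covers_mem q jj') (covers_mem q xx').
  by case/andP=> /(fintype.subsetP jx) -> ->.
have [M MP] := max_ex jj'; have [tM j'M maxM] := MP.
have MP' : is_max x' t M.
  have x'M := maxM _ j'x' xx'.1; split=> // u x'u; apply: maxM.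
  exact: fintype.subset_trans x'u.
by split=> kP; [rewrite (is_max_inj kP MP) | rewrite (is_max_inj kP MP')].
Qed.

(** For refinement, if no member of [B] inverted [t], then [x'] would bound [B] and hence [x].
    Incomparability comes from [min_other]. *)
Lemma is_CJR_canonical x : is_CJR x (canonical_joinands x).
Proof.
split.
- split=> [j [t [x' [xx' [tj jx minj]]]]|u ub]; first by rewrite leE.
  rewrite leE; apply: join_min => t x' j xx' jP.
  by rewrite -leE; apply: ub; exists t, x'.
- move=> j1 j2 [t1 [x1 [xx1 jP1]]] [t2 [x2 [xx2 jP2]]] j12.
  have [t12|t12] := eqVneq t1 t2; last first.
    have /negP[] := min_other xx2 xx1 t12 jP2.
    by rewrite leE in j12; apply: (fintype.subsetP j12); have [] := jP1.
  apply/eqP; rewrite eq_le j12 /= leE; have [_ _ min2] := jP2.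
  by apply: min2; have [tj jx _] := jP1; rewrite -?t12.
move=> B [ubB lubB] j [t [x' [xx' [tj jx minj]]]].
suff [b Bb tb] : exists2 b, B b & t \in N b.
  by exists b => //; rewrite leE; apply: minj => //; rewrite -leE; exact: ubB.
apply: contrapT => noB; have /le_gtF : (x <= (x' : L))%O; last by rewrite (covers_lt xx').
apply: lubB => b Bb; rewrite leE; apply/fintype.subsetP => q bq.
have := ubB b Bb; rewrite leE => bx.
rewrite (covers_mem q xx') (fintype.subsetP bx) //=.
by apply/eqP => qt; apply: noB; exists b; rewrite -?qt.
Qed.

Lemma is_CJR_inj x A B : is_CJR x A -> is_CJR x B -> A = B.
Proof.
have sub A' B' : is_CJR x A' -> is_CJR x B' -> A' `<=` B'.
  move=> [supA antiA refA] [supB antiB refB] a Aa.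
  have [b Bb ab] := refA _ supB a Aa; have [a' Aa' ba'] := refB _ supA b Bb.
  have aa' : a = a' by apply: antiA => //; exact: le_trans ba'.
  by rewrite (_ : a = b) //; apply/eqP; rewrite eq_le ab aa'.
by move=> xA xB; apply/seteqP; split; exact: sub.
Qed.

Lemma is_ext_kappaE x k : is_ext_kappa x k <-> ext_kappa G x k.
Proof.
have kappaE t x' j kj : covers x t x' -> is_min x t j -> is_kappa j kj <-> is_max x' t kj.
  move=> xx' jP; have [[j' jj'] _] := is_min_cover jP.
  by rewrite (is_kappa_max _ jP jj') (is_max_min _ xx' jP jj').
split=> [[A /is_CJR_inj -/(_ _ (is_CJR_canonical x)) -> [kap kapP [lb glb]]]|kP].
  move=> u; rewrite -leE; split=> [uk t x' m xx' mP|um].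
    have [j jP] := min_ex xx'.
    have Aj : canonical_joinands x j by exists t, x'.
    have := kapP _ Aj; rewrite (kappaE t x' j _ xx' jP) => mP'.
    rewrite (is_max_inj mP mP') -leE; apply: le_trans uk _; apply: lb.
    by exists j.
  apply: glb => _ [j [t [x' [xx' jP]]] <-].
  rewrite leE; apply: (um _ _ _ xx'); rewrite -(kappaE t x' j _ xx' jP).
  by apply: kapP; exists t, x'.
exists (canonical_joinands x); first exact: is_CJR_canonical.
(* On canonical joinands a kappa value exists by [max_ex], so [xget] returns a genuine one. *)
pose kap j : L := xget j (is_kappa j).
have kapP j : canonical_joinands x j -> is_kappa j (kap j).
  move=> [t [x' [xx' jP]]]; apply: xgetPex.
  by have [m mP] := max_ex xx'; exists m; apply/(kappaE t x').
exists kap => //; split=> [_ [j Aj <-]|u lb].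
  have [t [x' [xx' jP]]] := Aj.
  rewrite leE; apply: ((kP k).1 (subxx _) t x') => //; apply/(kappaE t x' j) => //.
  exact: kapP.
rewrite leE; apply/kP => t x' m xx' mP; have [j jP] := min_ex xx'.
have Aj : canonical_joinands x j by exists t, x'.
have := kapP _ Aj; rewrite (kappaE t x' j _ xx' jP) => mP'.
by rewrite (is_max_inj mP mP') -leE; apply: lb; exists j.
Qed.

Theorem kappa_leE x y : kappa_le L x y <->
  (forall p, in_shards G y p -> in_shards G x p).
Proof.
split=> [[xy [kx [ky [/is_ext_kappaE xP /is_ext_kappaE yP kyx]]]]|sub].
  by apply/(in_shards_sub_iff xP yP); rewrite -!leE.
have [kx xP] := ext_kappa_ex G x; have [ky yP] := ext_kappa_ex G y.
have /(in_shards_sub_iff xP yP)[xy kyx] := sub.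
split; first by rewrite leE.
by exists kx, ky; split; [exact/is_ext_kappaE | exact/is_ext_kappaE | rewrite leE].
Qed.

End KappaOrderWeak.

(** * The hyperplane arrangement *)

Section Hyperplanes.
Variables (R : realType) (n : nat).
Local Notation V := 'cV[R]_n.
Implicit Types (a b c u v p : V) (E : set V).

Lemma dot_project a b : a != 0 -> dot (b - (dot b a / dot a a) *: a) a = 0.
Proof. by move=> /dot_gt0 aa; rewrite dotBl dotZl -mulrA mulVf ?gt_eqF // mulr1 subrr. Qed.

Lemma independent_dual a b : a != 0 -> (forall k, b != k *: a) ->
  exists2 v, dot v a = 0 & 0 < dot v b.
Proof.
move=> a0 indep; pose v := b - (dot b a / dot a a) *: a.
have va : dot v a = 0 by exact: dot_project.
exists v => //; rewrite (_ : dot v b = dot v v).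
  by apply: dot_gt0; rewrite subr_eq0.
by rewrite {3}/v dotBr dotZr va mulr0 subr0.
Qed.

(** Project [b] and [c] orthogonally to [a]; the projections are proportional by
    [same_kernel_scale]. *)
Lemma two_kernel_span a b c : a != 0 ->
  (forall v, dot v a = 0 -> dot v b = 0 -> dot v c = 0) ->
  exists x y, c = x *: b + y *: a.
Proof.
move=> a0 abc; pose pr u := u - (dot u a / dot a a) *: a.
have pra u : dot (pr u) a = 0 by exact: dot_project.
have dot_pr u v : dot v a = 0 -> dot v (pr u) = dot v u.
  by move=> va; rewrite dotBr dotZr va mulr0 subr0.
have prC u v : dot (pr v) u = dot v (pr u).
  by rewrite -dot_pr // dotBl dotZl (dotC a) pra mulr0 subr0.
have [b0|b0] := eqVneq (pr b) 0.
  have [|y ->] := @same_kernel_scale _ _ a c a0.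
    move=> v va; apply: abc => //; rewrite -dot_pr // b0 dotC.
    by rewrite -(scale0r a) dotZl mul0r.
  by exists 0, y; rewrite scale0r add0r.
have [|x e] := @same_kernel_scale _ _ (pr b) (pr c) b0.
  by move=> v vb; rewrite -prC; apply: abc => //; rewrite prC.
exists x, (dot c a / dot a a - x * (dot b a / dot a a)).
rewrite scalerBl -(scalerA x) addrCA -scalerBr -/(pr b) -e.
by rewrite addrC subrK.
Qed.

(** If [b] vanished at [v], a small step inside the hyperplane of [a] would make it negative while
    staying in [E]. *)
Lemma wall_strict E a b v : a != 0 -> (forall k, b != k *: a) ->
  (forall p, E p -> 0 <= dot p b) -> dot v a = 0 ->
  within [set u | dot u a = 0] (nbhs v) E -> 0 < dot v b.
Proof.
move=> a0 indep Eb va nearE.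
have := nbhs_singleton nearE => /(_ va)/Eb.
rewrite le_eqVlt => /predU1P[/esym vb|//]; exfalso.
have [e ea eb] := independent_dual a0 indep.
have := @segment_continuous R n v (- e) 0 _; rewrite scale0r addr0 => /(_ _ nearE).
case/nbhs_ballP => d /= d0 /(_ (d / 2)).
have d2 : 0 < d / 2 by rewrite divr_gt0.
rewrite /ball /= sub0r normrN gtr0_norm // ltr_pdivrMr // ltr_pMr // ltr1n => /(_ isT).
rewrite /= dotDl dotZl dotNl va ea oppr0 mulr0 addr0 => /(_ erefl)/Eb.
by rewrite dotDl dotZl dotNl vb add0r mulrN oppr_ge0 leNgt mulr_gt0.
Qed.

Lemma strict_wall (I : finType) (P : I -> Prop) (f : I -> V) E v :
  (forall i, P i -> 0 < dot v (f i)) ->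
  within E (nbhs v) [set p | forall i, P i -> 0 <= dot p (f i)].
Proof.
move=> pos.
have : \forall p \near v, forall i, P i -> 0 <= dot p (f i).
  apply: (@filter_forall _ I (fun i p => P i -> 0 <= dot p (f i)) (nbhs v)) => i.
  have [Pi|nPi] := pselect (P i); last first.
    by apply: nearW => p /nPi.
  have near0 := cvgr_ge _ (@dot_continuous R n (f i) v) _ (pos i Pi).
  by apply: (filterS _ (near0 _)) => p p0 _.
by move=> near0; apply: (filterS _ near0) => p p0 _.
Qed.

End Hyperplanes.

Lemma reflection_inj (W : finGroupType) (R : realType) (n : nat)
    (rho : mx_representation R [set: W]%G n) t r k (a : 'cV[R]_n) :
  mx_faithful rho -> is_normal (rho t) a -> is_normal (rho r) (k *: a) -> t = r.
Proof.
move=> faithful [a0 ta] [ka0 ra].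
have k0 : k != 0 by apply: contra_neq ka0 => ->; rewrite scale0r.
apply: (mx_faithful_inj faithful); rewrite ?finset.in_setT //.
have e (v : 'cV[R]_n) : rho t *m v = rho r *m v.
  rewrite ta ra !(dotZl, dotZr) scalerA; congr (_ - _ *: _).
  have := dot_gt0 a0 => aa; field; rewrite k0 gt_eqF //.
apply/matrixP => i j; have := congr1 (fun M : 'cV[R]_n => M i 0) (e (delta_mx j 0)).
by rewrite -!colE !mxE.
Qed.

(** * Chamber data from a realization *)

Section Realization.
Variables (W : finGroupType) (C : coxeter_system W) (R : realType) (n : nat).
Variables (rho : mx_representation R [set: W]%G n).
Local Notation V := 'cV[R]_n.
Local Notation T := (reflections rho).

(** A generic point whose component has closure [D] serves as [base] and fixes the signs of the
    roots. Interior points of walls come from [real_walls]; [wall_strict] makes them strict. *)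
Lemma realization_chamber D : is_realization C rho D ->
  exists G : chamber_data C rho, D = [set p | forall t, t \in T -> 0 <= ht G t p].
Proof.
move=> [faithful refl [v v_gen defD] walls].
have choose_root t : exists a, t \in T -> is_normal (rho t) a /\ 0 < dot v a.
  have [/reflectionP[a na]|Tt] := pselect (t \in T); last by exists 0.
  have va : dot v a != 0.
    apply/eqP => va; apply: v_gen; exists (fixed_space (rho t)).
      by exists t => //=; exists a; [exact: na.1|exact: na.2].
    by rewrite (fixed_normal na).
  have [va0|va0] := ltrP 0 (dot v a); first by exists a.
  exists (- a) => _; split; last by rewrite dotNr oppr_gt0 lt_neqAle va.
  have [a0 ta] := na; split; first by rewrite oppr_eq0.
  by move=> u; rewrite ta !(dotNl, dotNr) opprK mulrN mulNr scaleNr scalerN opprK.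
have [root rootP] := choice choose_root.
have root_normal t (Tt : t \in T) : is_normal (rho t) (root t) := (rootP t Tt).1.
have root_pos t (Tt : t \in T) : 0 < dot v (root t) := (rootP t Tt).2.
have defD' : D = [set p | forall t, t \in T -> 0 <= dot p (root t)].
  have -> : D = [set p | [set: V] p /\ forall t, t \in T -> 0 <= dot v (root t) * dot p (root t)].
    rewrite -(@closure_component_signs R n W (fun t => t \in T) root [set: V] _ v) //.
    - rewrite -defD; congr (closure (connected_component _ v)).
      apply/seteqP; split=> p /=.
        move=> pgen; split=> // t Tt; apply/eqP => pt; apply: pgen.
        exists (fixed_space (rho t)); last by rewrite (fixed_normal (root_normal t Tt)).
        have [? ?] := root_normal t Tt.
        by exists t => //=; exists (root t).
      move=> [_ pgen] [_ [t /= [a a0 ta] <-]].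
      have Tt : t \in T by apply/reflectionP; exists a.
      by rewrite (fixed_normal (root_normal t Tt)) /= => /eqP; exact/negP/pgen.
    - by split=> // t Tt; rewrite gt_eqF ?root_pos.
  apply/seteqP; split=> p /=.
    by move=> [_ pD] t Tt; have := pD t Tt; rewrite pmulr_rge0 ?root_pos.
  by move=> pD; split=> // t Tt; rewrite pmulr_rge0 ?root_pos // pD.
have simple_T s : s \in simple C -> s \in T.
  by move=> /refl[a a0 sa]; apply/reflectionP; exists a.
have choose_wall s : exists w, s \in simple C -> dot w (root s) = 0 /\
    forall t, t \in T -> t != s -> 0 < dot w (root t).
  have [Ss|nS] := pselect (s \in simple C); last by exists 0.
  have : [set fixed_space (rho s) | s in [set s | s \in simple C]] (fixed_space (rho s)).
    by exists s.
  rewrite -walls => -[_ [w]].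
  rewrite (fixed_normal (root_normal s (simple_T s Ss))) /= => ws near_w.
  exists w => _; split=> // t Tt ts.
  apply: (wall_strict (root_normal s (simple_T s Ss)).1 _ _ ws near_w).
    move=> k; apply: contra_neq ts => e; apply/esym.
    apply: (reflection_inj (k := k) faithful (root_normal s (simple_T s Ss))).
    by rewrite -e; exact: root_normal.
  by move=> p; rewrite defD' => /(_ t Tt).
have [wall wallP] := choice choose_wall.
exists (@ChamberData W C R n rho root v wall faithful root_normal root_pos simple_T
  (fun s Ss => (wallP s Ss).1) (fun s t Ss => (wallP s Ss).2 t)).
exact: defD'.
Qed.

End Realization.

(** * Shards of the arrangement as sign cones *)

Section FrozenShards.
Variables (W : finGroupType) (C : coxeter_system W) (R : realType) (n : nat).
Variables (rho : mx_representation R [set: W]%G n) (G : chamber_data C rho).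
Variable (D : set 'cV[R]_n).
Hypothesis chamberE : D = [set p | forall t, t \in reflections rho -> 0 <= ht G t p].
Local Notation V := 'cV[R]_n.
Local Notation T := (reflections rho).
Local Notation S := (simple C).
Local Notation N := (inversions G).
Local Notation h := (ht G).
Local Notation act := (vact rho).
Local Notation A := (arrangement rho).
Local Notation H t := [set v : V | h t v = 0].
Implicit Types (q r s t w : W) (v p o : V).

Lemma root_inj t r k : t \in T -> r \in T -> pos_root G r = k *: pos_root G t -> r = t.
Proof.
move=> Tt Tr e; apply/esym; apply: (reflection_inj (k := k) (faithful_rho G) (pos_rootP G Tt)).
by rewrite -e; exact: pos_rootP.
Qed.

Lemma root_indep t r : t \in T -> r \in T -> r != t -> forall k, pos_root G r != k *: pos_root G t.
Proof. by move=> Tt Tr rt k; apply: contra_neq rt => /(root_inj Tt Tr). Qed.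

Lemma arrangementP X : A X <-> exists2 t, t \in T & X = H t.
Proof.
split=> [[t /= [a a0 ta] <-]|[t Tt ->]].
  have Tt : t \in T by apply/reflectionP; exists a.
  by exists t => //; exact: fixed_normal (pos_rootP G Tt).
exists t; last exact: fixed_normal (pos_rootP G Tt).
by have [a0 ta] := pos_rootP G Tt; exists (pos_root G t).
Qed.

Lemma hyperplane_inj t r : t \in T -> r \in T -> H t `<=` H r -> r = t.
Proof.
move=> Tt Tr tr; have a0 := (pos_rootP G Tt).1.
have [|k e] := @same_kernel_scale _ _ (pos_root G t) (pos_root G r) a0; first exact: tr.
exact: root_inj e.
Qed.

Definition in_rank2 t r q : Prop := q \in T /\ H t `&` H r `<=` H q.

Lemma rank2P t r X : rank2 A (H t) (H r) X <-> exists2 q, in_rank2 t r q & X = H q.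
Proof.
split=> [[/arrangementP[q Tq ->] sub]|[q [Tq sub] ->]]; first by exists q.
by split=> //; apply/arrangementP; exists q.
Qed.

(** Containing [D], and so [base], forces every sign of the rank 2 region to be positive. *)
Lemma rank2_region t r E : regions (rank2 A (H t) (H r)) E /\ D `<=` E <->
  E = [set p | forall q, in_rank2 t r q -> 0 <= h q p].
Proof.
have compl : (~` \bigcup_(K in rank2 A (H t) (H r)) K) =
    [set p | [set: V] p /\ forall q, in_rank2 t r q -> dot p (pos_root G q) != 0].
  apply/seteqP; split=> p /=.
    move=> gen; split=> // q Rq; apply/eqP => pq; apply: gen.
    by exists (H q) => //; apply/rank2P; exists q.
  by move=> [_ gen] [X /rank2P[q Rq ->] /= /eqP]; exact/negP/gen.
have clE v : (forall q, in_rank2 t r q -> dot v (pos_root G q) != 0) ->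
    closure (connected_component (~` \bigcup_(K in rank2 A (H t) (H r)) K) v) =
    [set p | [set: V] p /\ forall q, in_rank2 t r q -> 0 <= h q v * h q p].
  by move=> v0; rewrite compl closure_component_signs.
have Tq q : in_rank2 t r q -> q \in T by case.
split=> [[[v vgen <-] DE]|->].
  rewrite compl in vgen; have [_ v0] := vgen; rewrite clE // in DE *.
  have Dbase : D (base G) by rewrite chamberE => q ?; rewrite ltW ?ht_base.
  have [_ vb] := DE _ Dbase.
  have vpos q : in_rank2 t r q -> 0 < h q v.
    move=> Rq; rewrite lt_neqAle eq_sym (v0 q Rq) /=.
    by have := vb q Rq; rewrite pmulr_lge0 // ht_base ?Tq.
  apply/seteqP; split=> p /= => [[_ pE] q Rq|pE].
    by have := pE q Rq; rewrite pmulr_rge0 ?vpos.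
  by split=> // q Rq; rewrite mulr_ge0 ?pE // ltW ?vpos.
have b0 q : in_rank2 t r q -> dot (base G) (pos_root G q) != 0.
  by move=> Rq; rewrite gt_eqF // base_gt0 ?Tq.
split; last by move=> p; rewrite chamberE => pD q /Tq /pD.
exists (base G); first by rewrite compl.
rewrite clE //; apply/seteqP; split=> p /= => [[_ pE] q Rq|pE].
  by have := pE q Rq; rewrite pmulr_rge0 ?ht_base ?Tq.
by split=> // q Rq; rewrite mulr_ge0 ?pE // ltW ?ht_base ?Tq.
Qed.

Lemma basicP t r q : q \in T -> basic A D (H t) (H r) (H q) <->
  in_rank2 t r q /\
  exists2 v, h q v = 0 & forall q', in_rank2 t r q' -> q' != q -> 0 < h q' v.
Proof.
move=> Tq; split=> [[/rank2P[q0 [Tq0 sub] eq0] [E [regE DE [v qv near_v]]]]|[Rq [v qv pos]]].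
  have Rq : in_rank2 t r q by split=> //; rewrite eq0.
  split=> //; exists v => // q' Rq' q'q.
  apply: (wall_strict (pos_rootP G Tq).1 _ _ qv near_v).
    by apply: root_indep; rewrite // Rq'.1.
  have /rank2_region -> := conj regE DE.
  by move=> p; apply.
split; first by apply/rank2P; exists q.
exists [set p | forall q, in_rank2 t r q -> 0 <= h q p].
have /rank2_region[regE DE] := erefl [set p | forall q, in_rank2 t r q -> 0 <= h q p].
split=> //; exists v => //.
have := @strict_wall R n W (fun q' => in_rank2 t r q' /\ q' != q) (pos_root G) (H q) v.
case=> [q' [Rq' q'q]|e e0 sub]; first exact: pos.
exists e => // p ep pq q' Rq'; have [->|q'q] := eqVneq q' q; first by rewrite pq.
exact: (sub p ep pq q').
Qed.

(** Since [t] is not basic, a point [v'] of its hyperplane on the positive side of [r] has a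
    nonpositive root [q]. Evaluating [q = x r + y t] at [v] and [v'] gives [y > 0] and [x < 0];
    solving for [t] yields the combination. *)
Lemma cuts_cut t r : t \in T -> r \in T -> cuts A D (H r) (H t) -> cut G t r.
Proof.
move=> Tt Tr [_ _ tr].
have r_t : r != t by apply: contra_notN tr => /eqP->.
rewrite !basicP // => -[[_ sub] [v rv posv]] tN.
have tv : 0 < h t v.
  apply: posv; last by rewrite eq_sym.
  by split=> // p [].
have [v' tv' rv'] := independent_dual (pos_rootP G Tt).1 (root_indep Tt Tr r_t).
have [q [Rq qt qv']] : exists q, [/\ in_rank2 t r q, q != t & h q v' <= 0].
  apply: contrapT => none; apply: tN; split; first by split=> // p [].
  exists v' => // q' Rq' q't; rewrite ltNge; apply/negP => q'v'.
  by apply: none; exists q'.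
have Tq := Rq.1; have qr : q != r by apply: contraTneq qv' => ->; rewrite -ltNge.
have qv := posv q Rq qr.
have [x [y e]] := two_kernel_span (pos_rootP G Tt).1 (fun v a b => Rq.2 v (conj a b)).
have hE u : h q u = x * h r u + y * h t u by rewrite /ht e dotDr !dotZr.
have y0 : 0 < y by have := hE v; rewrite rv; nra.
have x0 : x < 0.
  have := hE v'; rewrite [h t v']tv' -/(h r v') in rv' *.
  have [x00 _|x_0 e'] := eqVneq x 0; last by rewrite lt_neqAle x_0 /=; nra.
  by move: qt; rewrite (root_inj Tt Tq (k := y)) ?eqxx // e x00 scale0r add0r.
exists q, (- x / y), y^-1; split; rewrite ?invr_gt0 ?divr_gt0 ?oppr_gt0 //.
rewrite e scalerDr !scalerA mulVf ?gt_eqF // scale1r addrA -scalerDl.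
by rewrite mulNr mulrC addNr scale0r add0r.
Qed.

(** Move from [base] along [- v'], which leaves [h t] constant, until a first hyperplane [r] of the
    rank 2 family is met; it is basic. [t] is not, as [a] and [b] cannot both be positive on its
    hyperplane. *)
Lemma cut_cuts t a : t \in T -> cut G t a ->
  exists2 r, r \in T & cuts A D (H r) (H t) /\ H t `&` H a = H t `&` H r.
Proof.
move=> Tt [b [c [d [[Ta Tb a_t b_t] c0 d0 e]]]].
have [v' tv' av'] := independent_dual (pos_rootP G Tt).1 (root_indep Tt Ta a_t).
pose bad q := `[< in_rank2 t a q >] && (0 < h q v').
pose lam q := h q (base G) / h q v'.
have bad_a : bad a by rewrite /bad av' andbT; apply/asboolP; split=> // p [].
case: (@Order.TotalTheory.arg_minP _ _ W a bad lam bad_a) => r /andP[/asboolP Rr rv'] min_r.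
have Tr := Rr.1.
pose v := base G - lam r *: v'.
have vE q : h q v = h q (base G) - lam r * h q v' by rewrite /v /ht dotBl dotZl.
have rv : h r v = 0 by rewrite vE /lam divfK ?subrr // gt_eqF.
have lam0 : 0 < lam r by rewrite divr_gt0 ?ht_base.
have nonneg q : in_rank2 t a q -> 0 <= h q v.
  move=> Rq; have q0 := ht_base G Rq.1; rewrite vE subr_ge0.
  have [qv'|qv'] := lerP (h q v') 0; first by apply: ltW; nra.
  by rewrite -ler_pdivlMr //; apply: min_r; rewrite /bad qv' andbT; apply/asboolP.
have tv : 0 < h t v by rewrite vE [h t v']tv' mulr0 subr0 ht_base.
have r_t : r != t by apply: contraTneq tv => <-; rewrite rv ltxx.
have [x [y er]] := two_kernel_span (pos_rootP G Tt).1 (fun v a b => Rr.2 v (conj a b)).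
have hr u : h r u = x * h a u + y * h t u by rewrite /ht er dotDr !dotZr.
have x0 : x != 0.
  apply: contraTneq rv' => x0; rewrite hr [h t v']tv' x0; lra.
have same : H t `&` H a = H t `&` H r.
  apply/seteqP; split=> p [/= tp]; rewrite /= hr tp mulr0 addr0.
    by move=> ->; rewrite mulr0.
  by move/eqP; rewrite mulf_eq0 (negPf x0) => /eqP.
have rank2E q : in_rank2 t r q <-> in_rank2 t a q by rewrite /in_rank2 same.
exists r => //; split=> //; split.
- by apply/arrangementP; exists t.
- by apply/arrangementP; exists r.
- move=> tr; have := hyperplane_inj Tt Tr; rewrite -tr => /(_ (fun p => id)).
  by apply/eqP.
- apply/basicP => //; split; first by apply/rank2E.
  exists v => // q /rank2E Rq qr; rewrite lt_neqAle nonneg // andbT eq_sym.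
  apply: contra qr => /eqP qv; apply/eqP.
  have /rank2E Rq' := Rq.
  (* A root vanishing at [v] has no component along [t], since [h t v] is positive, so it is
     proportional to that of [r]. *)
  have [x' [y' eq]] := two_kernel_span (pos_rootP G Tt).1 (fun v a b => Rq'.2 v (conj a b)).
  have hq u : h q u = x' * h r u + y' * h t u by rewrite /ht eq dotDr !dotZr.
  have y'0 : y' = 0.
    have := hq v; rewrite qv rv mulr0 add0r => /esym/eqP.
    by rewrite mulf_eq0 (gt_eqF tv) orbF => /eqP.
  by apply: (root_inj Tr Rq.1 (k := x')); rewrite eq y'0 scale0r addr0.
- move=> /basicP -/(_ Tt)[_ [w tw pos]].
  have := cut_ht w e; rewrite tw.
  have Ra : in_rank2 t r a by apply/rank2E; split=> // p [].
  have Rb : in_rank2 t r b.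
    apply/rank2E; split=> // p [/= tp ap].
    have := cut_ht p e; rewrite tp ap mulr0 add0r => /esym/eqP.
    by rewrite mulf_eq0 (gt_eqF d0) => /eqP.
  by have := pos a Ra a_t; have := pos b Rb b_t => *; nra.
Qed.

(** Removing the cutting hyperplanes removes exactly the zeros of the cutting roots;
    [closure_component_signs] then applies inside the hyperplane of [t]. *)
Lemma shards_inP t Z : t \in T -> shards_in A D (H t) Z <->
  exists v, [/\ h t v = 0, forall a, cut G t a -> h a v != 0 &
    Z = [set p | h t p = 0 /\ forall a, cut G t a -> 0 <= h a v * h a p]].
Proof.
move=> Tt.
have domE : H t `\` \bigcup_(X in [set X | cuts A D X (H t)]) (H t `&` X) =
    [set p | H t p /\ forall a, cut G t a -> dot p (pos_root G a) != 0].
  apply/seteqP; split=> p [tp gen]; split=> //.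
    move=> a cta; apply/eqP => ap; have [r Tr [cr same]] := cut_cuts Tt cta.
    by apply: gen; exists (H r) => //; rewrite -same.
  move=> [X /= cX [_ Xp]]; have [_ /arrangementP[r Tr XE] _ _ _] := cX.
  rewrite XE in cX Xp; have := gen r (cuts_cut Tt Tr cX).
  by move=> /eqP; apply.
have closE v : [set p | H t p /\ forall a, cut G t a -> dot p (pos_root G a) != 0] v ->
    closure (connected_component (H t `\` \bigcup_(X in [set X | cuts A D X (H t)]) (H t `&` X)) v)
    = [set p | h t p = 0 /\ forall a, cut G t a -> 0 <= h a v * h a p].
  move=> v0; rewrite domE closure_component_signs //.
    by move=> u w k _ /= tu tw; rewrite /ht dotDl dotZl dotBl -!/(h t _) tu tw; ring.
  apply: (@preimage_closed _ _ (fun p : V => dot p (pos_root G t)) [set 0]).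
    by move=> p _; exact: dot_continuous.
  exact: closed_eq.
split=> [[v v0 <-]|[v [tv cv ->]]].
  have [tv cv] : [set p | H t p /\ forall a, cut G t a -> dot p (pos_root G a) != 0] v.
    by rewrite -domE.
  by exists v; rewrite closE.
exists v; first by rewrite domE.
exact: closE.
Qed.

Lemma region_sign w p r : region rho D w p -> r \in T ->
  (r \in N w -> h r p <= 0) /\ (r \notin N w -> 0 <= h r p).
Proof.
move=> [v]; rewrite chamberE => vD <- Tr; have [c c0 e] := ht_vact G w Tr.
rewrite -[_ *m v]/(act w v) e; have := vD (r ^ w)%g; rewrite (conj_reflection G) => /(_ Tr) v0.
by case: ifP => // _; split=> // _; rewrite ?mulNr ?oppr_le0 mulr_ge0 // ltW.
Qed.

Lemma facet_in_regions w t w' : covers G w t w' ->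
  (region rho D w `&` region rho D w') (facet_point G w t).
Proof.
move=> ww'; have [s [Ss w's ts]] := covers_simple ww'.
have Ds : D (wall_point G s).
  rewrite chamberE => r Tr; have [->|rs] := eqVneq r s; first by rewrite /ht wall_point0.
  by rewrite ltW // wall_point_gt0.
rewrite /facet_point ts conjgKV; split; exists (wall_point G s) => //.
rewrite -[LHS]/(act w' _) w's vactM (act_reflection (G := G) (simple_reflection G Ss)) //.
by rewrite /ht wall_point0.
Qed.

Lemma facet_cut w t w' a : covers G w t w' -> cut G t a ->
  (h a (facet_point G w t) < 0) = (a \in N w) /\ (0 < h a (facet_point G w t)) = (a \notin N w).
Proof. by move=> ww' [? [? [? [[Ta _ at_ _] _ _ _]]]]; exact: facet_point_sign ww' Ta at_. Qed.

Lemma shard_at_facet w t w' v : covers G w t w' -> t \in T ->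
  (forall a, cut G t a -> h a v != 0 /\ 0 <= h a v * h a (facet_point G w t)) ->
  [set p | h t p = 0 /\ forall a, cut G t a -> 0 <= h a v * h a p] = [set p | in_shard G w t p].
Proof.
move=> ww' Tt vq.
have sgn a : cut G t a -> if a \in N w then h a v < 0 else 0 < h a v.
  move=> cta; have [v0 vqa] := vq a cta; have [neg pos] := facet_cut ww' cta.
  case: ifPn => aw; rewrite aw in neg pos; rewrite lt_neqAle ?v0 ?(eq_sym 0) ?v0 /=; nra.
apply/seteqP; split=> p /= [tp cp]; split=> // a cta; have := sgn a cta.
  have := cp a cta; case: ifP => _ vp va; split=> // _; nra.
have [neg pos] := cp a cta; case: ifPn => aw va; first by have := neg aw; nra.
by have := pos aw; nra.
Qed.

Theorem shard_meetE w : shard_meet C rho D w = [set p | in_shards G w p].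
Proof.
apply/seteqP; split=> p.
  move=> meet t w' ww'; have Tt := inv_refl (covers_in ww').
  apply: (meet [set p | in_shard G w t p]); split; last first.
    have [s [Ss w's ts]] := covers_simple ww'.
    exists s; split=> //.
      by rewrite -w's lt_neqAle (weak_leE G) (covers_sub ww') andbT;
         apply: contraTneq (covers_in ww') => <-; exact: ww'.1.
    rewrite -w's => u [uw uw'].
    have := region_sign uw' Tt; have := region_sign uw Tt.
    rewrite (covers_in ww') ww'.1 => -[tu _] [_ tu'].
    split=> [|a [? [? [? [[Ta _ _ _] _ _ _]]]]]; last exact: region_sign uw Ta.
    by apply/eqP; rewrite eq_le tu ?tu'.
  exists (H t); first by apply/arrangementP; exists t.
  apply/shards_inP => //; exists (facet_point G w t).
  have q0 a : cut G t a -> h a (facet_point G w t) != 0.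
    by move=> cta; have [neg pos] := facet_cut ww' cta; rewrite neq_lt neg pos orbN.
  split=> //; first exact: facet_point0 ww'.
  apply/esym/(shard_at_facet ww' Tt) => a cta; split; first exact: q0.
  by rewrite -expr2 sqr_ge0.
move=> wp Z [[X /arrangementP[t' Tt' ->] /shards_inP-/(_ Tt')[v [tv cv ->]]] [s [Ss lt_ws sub]]].
have ts : (s ^ w^-1)%g \in N w.
  apply: contraTT lt_ws => sw; apply/negP => /ltW; rewrite (weak_leE G) => /fintype.subsetP.
  have Ts : (s ^ w^-1)%g \in T by rewrite (conj_reflection G) (simple_reflection G).
  move/(_ (s ^ w^-1)%g); rewrite (in_inv_mul_simple G w Ss Ts) (negPf sw) eqxx.
  by move/(_ isT).
have ww' := simple_covers Ss ts; have Tt := inv_refl ts.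
have := sub _ (facet_in_regions ww') => /= -[tq cq].
(* The facet point lies on the hyperplane of its own label only, so the shard is in that
   hyperplane. *)
have tt' : t' = (s ^ w^-1)%g.
  apply/eqP; apply: contraT => tt'; have [neg pos] := facet_point_sign ww' Tt' tt'.
  by move: neg pos; rewrite tq ltxx; case: (_ \in _).
rewrite -tt' in ww' Tt cq *.
have /seteqP[_ in_Z] := shard_at_facet ww' Tt (fun a cta => conj (cv a cta) (cq a cta)).
by apply: in_Z; exact: wp ww'.
Qed.

End FrozenShards.

Theorem corollary4 (W : finGroupType) (C : coxeter_system W)
    (R : realType) (n : nat) (rho : mx_representation R [set: W]%G n)
    (D : set 'cV[R]_n) (hreal : is_realization C rho D) (x y : W) :
  shard_le C rho D x y <-> kappa_le (weak C) x y.
Proof.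
have [G chamberE] := realization_chamber hreal.
rewrite /shard_le !(shard_meetE chamberE); apply: iff_sym.
exact: kappa_leE.
Qed.
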